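(* Let $n \geq 5$ be an integer with $n \equiv 1 \pmod 4$. Then $m_3(n) \geq n+1$, where $m_3(n)$ denotes the minimum size of a good placement of queens on the $n \times n$ chessboard. Equivalently, every good placement on the $n\times n$ board contains at least $n+1$ queens.
   Context: For $n$ odd, the $n\times n$ board is the set of squares $\overline{B}_n = \left\{-\frac{n-1}{2},\ldots,\frac{n-1}{2}\right\} \times \left\{-\frac{n-1}{2},\ldots,\frac{n-1}{2}\right\} \subset \mathbb{Z}^2$. A line means a line in the plane of slope $0$, $+1$, $-1$ or $\infty$ containing points of the lattice $\mathbb{Z}^2$ (that is, a row, a column, or a diagonal in either of the two diagonal directions, of any length). A placement (of queens) on the board is a subset $\mathcal{Q} \subseteq \overline{B}_n$; its elements are called queens and its size is $|\mathcal{Q}|$. Three queens are in a line if three distinct elements of $\mathcal{Q}$ lie on a common line of slope $0$, $+1$, $-1$ or $\infty$ (they need not be adjacent or consecutive, and other queens or empty squares may lie between them). A placement $\mathcal{Q}$ on the board is called good if it contains no three queens in a line, and for every unoccupied square $s \in \overline{B}_n \setminus \mathcal{Q}$ the placement $\mathcal{Q} \cup \{s\}$ does contain three queens in a line. The number $m_3(n)$ is the minimum of $|\mathcal{Q}|$ over all good placements $\mathcal{Q}$ on the $n\times n$ board (the answer to the queens version of Martin Gardner's minimum no-3-in-a-line problem). *)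

(* Defs.v *)
From mathcomp Require Import all_boot all_order all_algebra.
From mathcomp Require Import finmap boolp zify.

Set Implicit Arguments.
Unset Strict Implicit.
Unset Printing Implicit Defensive.

Import Order.TTheory GRing.Theory Num.Theory.
Local Open Scope fset_scope.

Definition square : Type := (int * int)%type.

(* For odd n this is {-(n-1)/2, ..., (n-1)/2}. *)
Definition axis (n : nat) : {fset int} :=
  [fset (i%:Z - (n.-1./2)%:Z)%R | i in iota 0 n].

Definition board (n : nat) : {fset square} := axis n `*` axis n.

Inductive slope := Slope0 | Slope1 | SlopeN1 | SlopeInf.

(* The lines of a given slope that meet Z^2 are exactly those with an equation
   y = c, y - x = c, y + x = c or x = c (slopes 0, 1, -1, infinity) for which
   c is an integer; [Line s c] is that line. *)
Record line := Line { line_slope : slope; line_const : int }.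

Definition on_line (l : line) (p : square) : Prop :=
  let: (x, y) := p in
  match line_slope l with
  | Slope0 => y = line_const l
  | Slope1 => (y - x)%R = line_const l
  | SlopeN1 => (y + x)%R = line_const l
  | SlopeInf => x = line_const l
  end.

Definition three_in_line (Q : {fset square}) : Prop :=
  exists (p q r : square) (l : line),
    [/\ [/\ p \in Q, q \in Q & r \in Q],
        [/\ p <> q, p <> r & q <> r] &
        [/\ on_line l p, on_line l q & on_line l r]].

Definition good (n : nat) (Q : {fset square}) : Prop :=
  [/\ Q `<=` board n,
      ~ three_in_line Q &
      forall s : square, s \in board n `\` Q -> three_in_line (s |` Q)].

Definition good_size (n k : nat) : Prop :=
  exists2 Q : {fset square}, good n Q & #|` Q| = k.

Lemma mem_board (n : nat) (x y : int) : odd n ->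
  ((x, y) \in board n) =
    ((- (n.-1./2)%:Z <= x <= (n.-1./2)%:Z) &&
     (- (n.-1./2)%:Z <= y <= (n.-1./2)%:Z))%R.
Proof.
move=> oddn.
have mem_axis z : (z \in axis n) = (- (n.-1./2)%:Z <= z <= (n.-1./2)%:Z)%R.
  apply/imfsetP/idP => /= [[i]|zP].
    by rewrite mem_iota => ? ->; lia.
  by exists `|(z + (n.-1./2)%:Z)%R|%N; rewrite ?mem_iota; lia.
by rewrite in_fsetM /= !mem_axis.
Qed.

Lemma good_size_exists (n : nat) : exists k, `[< good_size n k >].
Proof.
pose P k := `[< exists Q : {fset square},
  [/\ Q `<=` board n, ~ three_in_line Q & #|` Q| = k] >].
have exP : exists k, P k.
  exists 0; apply/asboolP; exists fset0; split; rewrite ?fsub0set ?cardfs0 //.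
  by case=> p [q [r [l [[]]]]].
have ubP k : P k -> k <= #|` board n|.
  by move=> /asboolP[Q [sQ _ <-]]; apply: fsubset_leq_card.
case: (ex_maxnP exP ubP) => k /asboolP[Q [sQ n3Q cQ]] maxk.
exists k; apply/asboolP; exists Q => //; split=> // s.
rewrite in_fsetD => /andP[sNQ sB]; apply: contrapT => n3.
have /maxk : P k.+1; last by rewrite ltnn.
apply/asboolP; exists (s |` Q); split=> //; last by rewrite cardfsU1 sNQ cQ.
by rewrite fsubUset fsub1set sB.
Qed.

Definition m3 (n : nat) : nat := ex_minn (good_size_exists n).

(* Main.v *)
Require Import Defs.
From mathcomp Require Import all_boot all_order all_algebra.
From mathcomp Require Import finmap boolp.
From mathcomp Require Import zify ring.

(** Write n = 2k + 1, so k is even and positive, and suppose that a good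
    placement Q has at most n queens.  Call a line full if it holds two queens.
    An empty square lies on a full line, so the only squares of the board on no
    full line are the lonely queens, those that share no line with another
    queen.  If a direction has s full lines and there are e lonely queens, then
    2s + e <= n; so when e <> 1, or when some direction has fewer than k full
    lines, lines through the lonely queens can be added so that the board is
    covered by k lines of each direction ([lonely_queen_unique]).

    Such a cover does not exist ([no_full_cover]).  At least k + 1 columns and
    k + 1 rows are left, forming sets U and V, and U x V must be covered by k
    diagonals and k antidiagonals.  Look at the bounding box of U x V.  Two
    opposite sides, the short ones if the box is not square, carry 2k + 2 points
    at least, while a line of slope 1 or -1 meets these sides at most once,
    unless it is a main diagonal of a square box.
    Hence the box is square, both main diagonals are used and everything is
    tight; comparing the four sides shows that the k - 1 other diagonals lie
    half above and half below the main one, so k is odd.  The same argument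
    works with one uncovered point inside the box.

    There remains the case of one lonely queen (a, b) on the border of the box,
    with k full lines in each direction, |U| = |V| = k + 1 and (a, b) the one
    point of U x V off the diagonals y - x = d (d in D) and the antidiagonals
    x + y = s (s in S).  Here the weights of the Combinatorial Nullstellensatz
    help ([leading_weights]): the functional L with L(g) the weighted sum of g
    over U x V vanishes in degree below 2k and reads the coefficient of x^k y^k
    in degree 2k.  The product f of the 2k linear forms is zero on U x V except
    at (a, b), so L(f g) = c g(a, b) for all g, with c = L(f) nonzero because k
    is even.  Taking g = y - x, x + y and (y - x)(x + y) yields the sums of the
    coordinates a and b in terms of U, V, D, S, and the equality of the
    variances of U and V ([one_exception]).  Counting queens by columns, rows
    and diagonals expresses the sums of D and S by those of U and V, and then
    a is twice the sum of U and b twice the sum of V.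

    Let W be the side of the box and let (a, b) be on its left side, which is no
    restriction by symmetry.

    - If (a, b) is a corner, the opposite corner is covered by an antidiagonal
      that has no other point in the box.  Dropping that line gives a product of
      degree 2k - 1 with two exceptional points; the test functions of degree at
      most 2 then show that the mean of x + y over the two corners is its mean
      over U x V ([two_exceptions]).  This says (2k + 1)(a + b + W) = - W, which
      contradicts 0 < W <= 2k ([no_corner_exception]).
    - Otherwise the counts on the four sides are forced: the lines meet the top
      and the bottom exactly in U, the left side in V without b, and the right
      side in V and one further point z.  Comparing the sums of the hits, and of
      their squares, with offsets taken from the centre of the box, shows that z
      mirrors b and that U and V have the same second moment about the centre.
      As their variances agree, their means are equally far from the centre,
      which makes W + t or W - t a multiple of 4k + 2, where t is twice the
      offset of b; this contradicts |t| < W <= 2k ([no_side_exception]). *)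

Set Implicit Arguments.
Unset Strict Implicit.
Unset Printing Implicit Defensive.

Import Order.TTheory GRing.Theory Num.Theory.
Local Open Scope ring_scope.

(** * Interpolation weights *)

(** The leading coefficient of the Lagrange interpolant on k + 1 points is a
    weighted sum of values.  Adding a point x to U replaces p by its divided
    difference (p - p(x)) / (X - x), whose leading coefficient is that of p. *)
Lemma leading_weights (F : fieldType) (k : nat) (U : seq F) :
  uniq U -> size U = k.+1 ->
  exists w : F -> F, forall p : {poly F}, (size p <= k.+1)%N ->
    \sum_(u <- U) w u * p.[u] = p`_k.
Proof.
elim: k U => [|k IH] [|x U] //= /andP[xU uU] [sU].
  case: U sU {xU uU} => // _; exists (fun=> 1) => p sp.
  by rewrite big_seq1 mul1r (size1_polyC sp) hornerC coefC.
have [w Hw] := IH U uU sU.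
pose r := - \sum_(u <- U) w u / (u - x).
exists (fun u => if u == x then r else w u / (u - x)) => p sp.
have /factor_theorem[q Eq] : root (p - p.[x]%:P) x.
  by rewrite rootE !hornerE subrr.
have Ep : p = q * ('X - x%:P) + p.[x]%:P by rewrite -Eq subrK.
have sq : (size q <= k.+1)%N.
  have [->|qn0] := eqVneq q 0; first by rewrite size_poly0.
  have : (size (q * ('X - x%:P))%R <= k.+2)%N.
    rewrite -Eq (leq_trans (size_polyD _ _)) // geq_max sp size_polyN.
    by rewrite (leq_trans (size_polyC_leq1 _)).
  by rewrite size_Mmonic ?monicXsubC // size_XsubC addn2.
rewrite big_cons eqxx.
have -> : p`_k.+1 = q`_k.
  rewrite Ep coefD coefC addr0 mulrBr coefB coefMX coefMC /=.
  by rewrite [q`_k.+1]nth_default // mul0r subr0.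
rewrite -Hw // /r mulNr mulr_suml addrC -sumrB.
rewrite big_seq [RHS]big_seq; apply: eq_bigr => u uin.
have ux : u != x by apply: contraNneq xU => <-.
rewrite (negPf ux) {1}Ep !hornerE.
by field; rewrite subr_eq0.
Qed.

(** * Coefficients of products of diagonal forms *)

Section DiagonalProducts.
Variable F : fieldType.

(** The dehomogenisation of (y - x)^i (x + y)^j at y = 1. *)
Definition diag_poly (i j : nat) : {poly F} := (1 - 'X) ^+ i * (1 + 'X) ^+ j.

Lemma size_diag_poly i j : (size (diag_poly i j) <= (i + j).+1)%N.
Proof.
have s1 (c : F) : (size (1 + c *: 'X : {poly F})%R <= 2)%N.
  rewrite (leq_trans (size_polyD _ _)) // geq_max size_poly1 /=.
  by rewrite (leq_trans (size_scale_leq _ _)) // size_polyX.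
have s2 (c : F) n : (size ((1 + c *: 'X : {poly F}) ^+ n)%R <= n.+1)%N.
  have := size_poly_exp_leq (1 + c *: 'X : {poly F}) n; have := s1 c; nia.
rewrite /diag_poly (leq_trans (size_polyMleq _ _)) //.
have := s2 (-1) i; have := s2 1 j; rewrite scaleN1r scale1r.
by move: (size _) => a; move: (size _) => b; lia.
Qed.

(** Homogenisation turns multiplication by 1 + cX into multiplication by
    y + cx; no division by y is involved, so y = 0 is allowed. *)
Lemma homogenize_mulX (c x y : F) (p : {poly F}) M : (size p <= M.+1)%N ->
  \sum_(r < M.+2) (p * (1 + c *: 'X))`_r * x ^+ r * y ^+ (M.+1 - r) =
  (y + c * x) * \sum_(r < M.+1) p`_r * x ^+ r * y ^+ (M - r).
Proof.
move=> sp.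
have E r : (p * (1 + c *: 'X))`_r = p`_r + c * (if r is s.+1 then p`_s else 0).
  by rewrite mulrDr mulr1 -scalerAr coefD coefZ coefMX; case: r.
under eq_bigr do rewrite E !mulrDl.
rewrite big_split /= mulrDl; congr (_ + _).
  rewrite big_ord_recr /= [p`_M.+1]nth_default // !mul0r addr0 mulr_sumr.
  apply: eq_bigr => r _; rewrite subSn; last by case: r.
  by rewrite exprS; ring.
rewrite big_ord_recl /= mulr0 !mul0r add0r mulr_sumr.
by apply: eq_bigr => r _; rewrite /= /bump /= add1n subSS exprS; ring.
Qed.

Lemma diag_expansion i j (x y : F) :
  (y - x) ^+ i * (x + y) ^+ j =
  \sum_(r < (i + j).+1) (diag_poly i j)`_r * x ^+ r * y ^+ (i + j - r).
Proof.
elim: i => [|i IHi].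
  elim: j => [|j IHj].
    by rewrite big_ord1 /diag_poly !expr0 !mul1r coef1 !mulr1.
  have -> : diag_poly 0 j.+1 = diag_poly 0 j * (1 + 1 *: 'X).
    by rewrite /diag_poly scale1r exprSr mulrA.
  rewrite add0n homogenize_mulX ?size_diag_poly // -[j in LHS]add0n.
  by rewrite -IHj exprS; ring.
have -> : diag_poly i.+1 j = diag_poly i j * (1 + (-1) *: 'X).
  by rewrite /diag_poly scaleN1r exprS; ring.
by rewrite addSn homogenize_mulX ?size_diag_poly // -IHi exprS; ring.
Qed.

Lemma coef_diff_squares n r :
  ((1 - 'X^2 : {poly F}) ^+ n)`_r =
  if odd r then 0 else (-1) ^+ r./2 * 'C(n, r./2)%:R.
Proof.
elim: n r => [|n IH] r.
  rewrite expr0 coef1; case: r => [|[|r]] //=; first by rewrite mulr1.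
  by case: ifP => _; rewrite // mulr0.
rewrite exprSr mulrBr mulr1 coefB coefMXn !IH.
case: r => [|[|r]] //=; first by rewrite !bin0 subr0.
  by rewrite subr0.
rewrite subSS subn1 /= negbK; case: ifP => _; first by rewrite subr0.
by rewrite binS natrD exprS; ring.
Qed.

End DiagonalProducts.

Section Coefficients.
Variable F : numFieldType.
Local Notation diag_poly := (@diag_poly F).

Lemma diag_poly_diag n : diag_poly n n = (1 - 'X^2) ^+ n.
Proof. by rewrite /diag_poly -exprMn; congr (_ ^+ n); ring. Qed.

Lemma diag_poly_mid_neq0 m : (diag_poly m.*2 m.*2)`_m.*2 != 0.
Proof.
rewrite diag_poly_diag coef_diff_squares odd_double doubleK.
by rewrite mulf_neq0 ?signr_eq0 // pnatr_eq0 -lt0n bin_gt0 -addnn leq_addr.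
Qed.

(** The odd coefficients of (1 - X^2)^(2m+1) vanish and its two middle even
    coefficients are opposite, so they cancel in the product with (1 +- X)^2. *)
Lemma coef_mul_sqr_eq0 m (c : F) : c ^+ 2 = 1 ->
  (diag_poly m.*2.+1 m.*2.+1 * (1 + c *: 'X) ^+ 2)`_m.*2.+2 = 0.
Proof.
move=> c2; rewrite diag_poly_diag; set p := _ ^+ m.*2.+1.
have -> : p * (1 + c *: 'X) ^+ 2 = p + (c *+ 2) *: (p * 'X) + p * 'X^2.
  by rewrite -[X in _ = _ + X]scale1r -c2 -!mul_polyC rmorphMn rmorphXn /=; ring.
rewrite !coefD coefZ coefMX coefMXn /= subSS subn1 /= !coef_diff_squares /=.
rewrite odd_double /= ?uphalf_double ?doubleK mulr0 addr0 exprS.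
have -> : 'C(m.*2.+1, m.+1) = 'C(m.*2.+1, m).
  by rewrite -(@bin_sub _ m.+1); last lia; congr 'C(_, _); lia.
by ring.
Qed.

Lemma diag_poly_near_mid_eq0 m :
  (diag_poly m.*2.+3 m.*2.+1)`_m.*2.+2 = 0 /\
  (diag_poly m.*2.+1 m.*2.+3)`_m.*2.+2 = 0.
Proof.
split.
  have -> : diag_poly m.*2.+3 m.*2.+1 =
      diag_poly m.*2.+1 m.*2.+1 * (1 + (-1) *: 'X) ^+ 2.
    by rewrite scaleN1r /diag_poly !exprS; ring.
  by apply: coef_mul_sqr_eq0; rewrite sqrrN expr1n.
have -> : diag_poly m.*2.+1 m.*2.+3 =
    diag_poly m.*2.+1 m.*2.+1 * (1 + 1 *: 'X) ^+ 2.
  by rewrite scale1r /diag_poly !exprS; ring.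
by apply: coef_mul_sqr_eq0; rewrite expr1n.
Qed.

(** Up to sign the coefficient is 2a - 6b with a = 'C(2m, m - 1) and
    b = 'C(2m, m), and a <= b. *)
Lemma diag_poly_far_neq0 m :
  (diag_poly m.*2.+4 m.*2)`_m.*2.+2 != 0.
Proof.
have -> : diag_poly m.*2.+4 m.*2 = (1 - 'X^2) ^+ m.*2 * (1 - 'X) ^+ 4.
  by rewrite -diag_poly_diag /diag_poly !exprS; ring.
set p := _ ^+ m.*2.
have -> : p * (1 - 'X) ^+ 4 = p - p * 'X *+ 4 + p * 'X^2 *+ 6
    - p * 'X^3 *+ 4 + p * 'X^4.
  by ring.
rewrite !(coefD, coefN, coefMn) coefMX !coefMXn /= !subSS {}/p.
case: m => [|m].
  rewrite expr0 !coef1 /= !(addr0, add0r, subr0).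
  by rewrite (_ : _ + _ = 6%:R) ?pnatr_eq0 //; ring.
rewrite doubleS /= !subSS ?subn0 !coef_diff_squares /= odd_double /=.
rewrite ?uphalf_double ?doubleK.
(* From here on m stands for the predecessor of the m of the statement. *)
set a := 'C(_, m); set b := 'C(_, m.+1).
have -> : 'C(m.*2.+2, m.+2) = a.
  by rewrite -(@bin_sub _ m.+2) -?addnn; [congr 'C(_, _) |]; lia.
have ab : ((2 * a)%N != (6 * b)%N).
  have := mul_bin_left m.*2.+2 m; rewrite -/a -/b.
  have -> : (m.*2.+2 - m = m.+2)%N by lia.
  have : (0 < b)%N by rewrite bin_gt0; lia.
  by nia.
have : (-1) ^+ m * ((2 * a)%:R - (6 * b)%:R) != 0 :> F.
  by rewrite mulf_neq0 ?signr_eq0 // subr_eq0 eqr_nat.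
apply: contraNneq => E0; rewrite -[X in _ == X]E0 !natrM !exprS.
by apply/eqP; ring.
Qed.

Lemma diag_poly_next_mid m : exists2 c : F, c != 0 &
  (diag_poly m.*2.+1 m.*2.+1)`_m.*2 = c /\
  (diag_poly m.*2.+1 m.*2.+1)`_m.*2.+2 = - c.
Proof.
exists ((-1) ^+ m * 'C(m.*2.+1, m)%:R).
  by rewrite mulf_neq0 ?signr_eq0 // pnatr_eq0 -lt0n bin_gt0; lia.
rewrite diag_poly_diag !coef_diff_squares /= odd_double /= doubleK.
split=> //; rewrite exprS mulN1r mulNr.
have -> : 'C(m.*2.+1, m.+1) = 'C(m.*2.+1, m); last by [].
by rewrite -(@bin_sub _ m.+1); last lia; congr 'C(_, _); lia.
Qed.
End Coefficients.

(** * Weighted sums over a centred grid *)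

Section Functional.
Variable F : numFieldType.

Lemma coef_second_prod_XsubC (U : seq F) n : size U = n.+2 ->
  (\prod_(u <- U) ('X - u%:P))`_n *+ 2 =
  (\sum_(u <- U) u) ^+ 2 - \sum_(u <- U) u ^+ 2.
Proof.
elim: U n => // x U IH n [sU]; rewrite !big_cons mulrBl coefB coefXM coefCM.
have -> : (\prod_(u <- U) ('X - u%:P))`_n = - \sum_(u <- U) u.
  by have := @coefPn_prod_XsubC F U; rewrite sU; apply.
case: n sU => [|n] sU /=; last by rewrite mulrnBl IH //; ring.
by case: U sU {IH} => [|y []] // _; rewrite !big_seq1; ring.
Qed.

(** Since the root polynomial Q of U vanishes on U, the moments beyond k come
    from reducing X^(k+1) and X^(k+2) modulo Q.  For a centred U the coefficient
    of X^k in Q is 0 and that of X^(k-1) is minus half the sum of squares. *)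
Lemma centred_weights k (U : seq F) : (0 < k)%N ->
  uniq U -> size U = k.+1 -> \sum_(u <- U) u = 0 ->
  exists w : F -> F, let mu r := \sum_(u <- U) w u * u ^+ r in
    [/\ forall r, (r < k)%N -> mu r = 0, mu k = 1, mu k.+1 = 0
      & mu k.+2 = (\sum_(u <- U) u ^+ 2) / 2].
Proof.
move=> k0 uU sU U0; have [w Hw] := leading_weights uU sU; exists w => mu.
have mu_low r : (r <= k)%N -> mu r = (r == k)%:R.
  move=> rk; rewrite eq_sym -coefXn -Hw ?size_polyXn ?ltnS //.
  by apply: eq_bigr => u _; rewrite hornerXn.
pose Q := \prod_(u <- U) ('X - u%:P) : {poly F}.
have Qmon : Q \is monic by apply: monic_prod_XsubC.
have sQ : size Q = k.+2 by rewrite size_prod_XsubC sU.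
have QU u : u \in U -> Q.[u] = 0.
  by move=> uin; apply/eqP; rewrite -/(root Q u) root_prod_XsubC.
have Qk1 : Q`_k.+1 = 1 by move/monicP: Qmon; rewrite lead_coefE sQ.
have Qk : Q`_k = 0.
  by have := @coefPn_prod_XsubC F U; rewrite sU U0 oppr0; apply.
have Qk' : Q`_k.-1 = - (\sum_(u <- U) u ^+ 2) / 2.
  have sU' : size U = k.-1.+2 by rewrite sU; lia.
  have := coef_second_prod_XsubC sU'; rewrite U0 expr0n sub0r => <-.
  by rewrite -/Q; field.
have mu_red s : (s <= 1)%N -> mu (k.+1 + s)%N = ('X^(k.+1 + s) - 'X^s * Q)`_k.
  move=> s1; rewrite -Hw.
    rewrite /mu big_seq [RHS]big_seq; apply: eq_bigr => u uin.
    by rewrite hornerD hornerN hornerM !hornerXn QU // mulr0 subr0.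
  apply/leq_sizeP => j kj; rewrite coefB coefXn coefXnM.
  case: ltnP => [|sj]; first by lia.
  have [->|jk] := eqVneq j (k.+1 + s)%N; first by rewrite addnK Qk1 subrr.
  have [js|js] := eqVneq (j - s)%N k; first by rewrite js Qk subrr.
  by rewrite nth_default ?subrr // sQ; lia.
split.
- by move=> r rk; rewrite mu_low ?(ltnW rk) // (ltn_eqF rk).
- by rewrite mu_low // eqxx.
- have := mu_red 0%N isT; rewrite addn0 => ->.
  by rewrite coefB coefXn coefXnM subn0 Qk /= (ltn_eqF (ltnSn k)) subr0.
have := mu_red 1%N isT; rewrite addn1 => ->.
rewrite coefB coefXn coefXnM ltnNge k0 /= subn1 Qk'.
by rewrite (ltn_eqF (ltnW (ltnSn k.+1))) sub0r mulNr opprK.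
Qed.

Variables (k : nat) (U V : seq F) (w w' : F -> F).

(** The functional of the Nullstellensatz: a product of weights on the grid. *)
Definition weighted_sum (g : F -> F -> F) :=
  \sum_(u <- U) \sum_(v <- V) w u * w' v * g u v.

Local Notation L := weighted_sum.
Local Notation mu r := (\sum_(u <- U) w u * u ^+ r).
Local Notation nu r := (\sum_(v <- V) w' v * v ^+ r).

Lemma weighted_sum_sum I (r : seq I) (P : pred I) (g : I -> F -> F -> F) :
  L (fun u v => \sum_(i <- r | P i) g i u v) =
  \sum_(i <- r | P i) L (g i).
Proof.
rewrite /L; under eq_bigr do under eq_bigr do rewrite mulr_sumr.
by under eq_bigr do rewrite exchange_big /=; rewrite exchange_big.
Qed.

Lemma weighted_sumZ c g : L (fun u v => c * g u v) = c * L g.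
Proof.
rewrite /L mulr_sumr; apply: eq_bigr => u _.
by rewrite mulr_sumr; apply: eq_bigr => v _; ring.
Qed.

Definition diag_moment i j := L (fun u v => (v - u) ^+ i * (u + v) ^+ j).
Local Notation N := diag_moment.

Lemma diag_momentE i j :
  N i j = \sum_(r < (i + j).+1) (diag_poly F i j)`_r * (mu r * nu (i + j - r)).
Proof.
rewrite /N /L; under eq_bigr do under eq_bigr do
  rewrite diag_expansion mulr_sumr.
under eq_bigr do rewrite exchange_big /=.
rewrite exchange_big /=; apply: eq_bigr => r _.
rewrite big_distrlr /= mulr_sumr; apply: eq_bigr => u _.
by rewrite mulr_sumr; apply: eq_bigr => v _; ring.
Qed.

Hypothesis mu_low : forall r, (r < k)%N -> mu r = 0.
Hypothesis mu_k : mu k = 1.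
Hypothesis mu_k1 : mu k.+1 = 0.
Hypothesis nu_low : forall r, (r < k)%N -> nu r = 0.
Hypothesis nu_k : nu k = 1.
Hypothesis nu_k1 : nu k.+1 = 0.

Lemma diag_moment_low i j : (i + j < k.*2)%N -> N i j = 0.
Proof.
move=> ijk; rewrite diag_momentE big1 // => r _.
have [rk|kr] := ltnP r k; first by rewrite mu_low // mul0r mulr0.
by rewrite [nu _]nu_low ?mulr0 //; have := ltn_ord r; lia.
Qed.

Lemma diag_moment_mid i j : (i + j = k.*2)%N -> N i j = (diag_poly F i j)`_k.
Proof.
move=> ijk; have kij : (k < (i + j).+1)%N by lia.
rewrite diag_momentE (bigD1 (Ordinal kij)) //=.
have -> : (i + j - k = k)%N by lia.
rewrite mu_k nu_k !mulr1.
rewrite big1 ?addr0 // => r; rewrite -val_eqE /= => rk.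
have [rk'|kr] := ltnP r k; first by rewrite mu_low // mul0r mulr0.
by rewrite [nu _]nu_low ?mulr0 //; have := ltn_ord r; lia.
Qed.

Lemma diag_moment_odd i j : (i + j = k.*2.+1)%N -> N i j = 0.
Proof.
move=> ijk; rewrite diag_momentE big1 // => r _.
have [rk|kr] := ltnP r k; first by rewrite mu_low // mul0r mulr0.
have [->|rk] := eqVneq (r : nat) k.
  have -> : (i + j - k = k.+1)%N by lia.
  by rewrite nu_k1 !mulr0.
have [->|rk1] := eqVneq (r : nat) k.+1; first by rewrite mu_k1 mul0r mulr0.
by rewrite [nu _]nu_low ?mulr0 //; have := ltn_ord r; lia.
Qed.

Lemma diag_moment_high i j : (i + j = k.*2.+2)%N ->
  N i j = (diag_poly F i j)`_k * nu k.+2 + (diag_poly F i j)`_k.+2 * mu k.+2.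
Proof.
move=> ijk; have kij : (k < (i + j).+1)%N by lia.
have kij2 : (k.+2 < (i + j).+1)%N by lia.
rewrite diag_momentE (bigD1 (Ordinal kij)) //= (bigD1 (Ordinal kij2)) /=; last first.
  by rewrite -val_eqE /=; lia.
have -> : (i + j - k = k.+2)%N by lia.
have -> : (i + j - k.+2 = k)%N by lia.
rewrite mu_k nu_k mul1r mulr1 [X in _ + (_ + X)]big1 ?addr0 // => r.
rewrite -!val_eqE /= => /andP[rk rk2].
have [rk'|kr] := ltnP r k; first by rewrite mu_low // mul0r mulr0.
have [->|rk1] := eqVneq (r : nat) k.+1; first by rewrite mu_k1 mul0r mulr0.
by rewrite [nu _]nu_low ?mulr0 //; have := ltn_ord r; lia.
Qed.

(** Moments of total degree below 2k and, by centring, of degree 2k + 1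
    vanish.  So of a product with degrees at most a + 1 and b + 1 in the two
    diagonal forms, where a + b = 2k, only four terms survive. *)
Lemma weighted_sum_poly a b (p q : {poly F}) : (0 < a)%N -> (0 < b)%N ->
  (a + b = k.*2)%N -> (size p <= a.+2)%N -> (size q <= b.+2)%N ->
  L (fun u v => p.[v - u] * q.[u + v]) =
  p`_a.+1 * q`_b.+1 * N a.+1 b.+1 + p`_a.+1 * q`_b.-1 * N a.+1 b.-1
  + p`_a * q`_b * N a b + p`_a.-1 * q`_b.+1 * N a.-1 b.+1.
Proof.
case: a => // a _; case: b => // b _ /= abk sp sq.
have E : L (fun u v => p.[v - u] * q.[u + v]) =
    \sum_(i < a.+3) p`_i * \sum_(j < b.+3) q`_j * N i j.
  under eq_bigr do rewrite mulr_sumr.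
  transitivity (L (fun u v => \sum_(i < a.+3) \sum_(j < b.+3)
      (p`_i * q`_j) * ((v - u) ^+ i * (u + v) ^+ j))).
    rewrite /L; apply: eq_bigr => u _; apply: eq_bigr => v _; congr (_ * _).
    rewrite (horner_coef_wide _ sp) (horner_coef_wide _ sq) big_distrlr /=.
    by apply: eq_bigr => i _; apply: eq_bigr => j _; ring.
  rewrite weighted_sum_sum; apply: eq_bigr => i _.
  rewrite weighted_sum_sum; apply: eq_bigr => j _.
  by rewrite weighted_sumZ mulrA.
rewrite {}E !big_ord_recr /=.
rewrite [X in X + _ + _ + _]big1 ?add0r; last first.
  move=> i _; rewrite big1 ?mulr0 // => j _.
  rewrite diag_moment_low ?mulr0 //.
  by have := ltn_ord i; have := ltn_ord j; lia.
have S i M : (i + M <= k.*2)%N -> \sum_(j < M) q`_j * N i j = 0.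
  move=> iM; rewrite big1 // => j _.
  by rewrite diag_moment_low ?mulr0 //; have := ltn_ord j; lia.
rewrite !S ?(@diag_moment_low a b) ?(@diag_moment_low a b.+1)
  ?(@diag_moment_low a.+1 b) ?(@diag_moment_odd a.+1 b.+2)
  ?(@diag_moment_odd a.+2 b.+1); try lia.
by ring.
Qed.

End Functional.

(** * Grids covered up to one or two points *)

Definition covered (R : zmodType) (D S : seq R) (u v : R) :=
  (v - u \in D) || (u + v \in S).

Section Exceptions.
Variable F : numFieldType.
Implicit Types (U V D S : seq F) (E : seq (F * F)).

Definition root_poly (s : seq F) : {poly F} := \prod_(x <- s) ('X - x%:P).

Lemma size_root_poly s : size (root_poly s) = (size s).+1.
Proof. by rewrite size_prod_XsubC. Qed.

Lemma coef_root_poly s n : size s = n.+1 ->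
  (root_poly s)`_n.+1 = 1 /\ (root_poly s)`_n = - \sum_(x <- s) x.
Proof.
move=> ss; have /monicP : root_poly s \is monic by apply: monic_prod_XsubC.
rewrite lead_coefE size_root_poly ss; split=> //.
by have := @coefPn_prod_XsubC F s; rewrite ss; apply.
Qed.

Lemma root_poly_eq0 s x : ((root_poly s).[x] == 0) = (x \in s).
Proof. by rewrite -/(root (root_poly s) x) root_prod_XsubC. Qed.

Lemma coef_shift_root_poly i s r :
  ('X^i * root_poly s)`_(i + r) = (root_poly s)`_r.
Proof. by rewrite coefXnM ltnNge leq_addr /= addKn. Qed.

Lemma size_shift_root_poly i s :
  (size ('X^i * root_poly s)%R <= i + (size s).+1)%N.
Proof.
by rewrite (leq_trans (size_polyMleq _ _)) // size_polyXn size_root_poly.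
Qed.

(** The value at q of the product of all the forms, times the weight of q. *)
Definition exception_weight D S (w w' : F -> F) (q : F * F) :=
  w q.1 * w' q.2 * ((root_poly D).[q.2 - q.1] * (root_poly S).[q.1 + q.2]).

(** The product of the forms is zero off E, so its weighted sums against test
    functions only see the points of E. *)
Lemma weighted_sum_exceptions U V D S E w w' i j :
  uniq U -> uniq V -> uniq E ->
  (forall q, q \in E -> q.1 \in U /\ q.2 \in V) ->
  (forall u v, u \in U -> v \in V -> (u, v) \notin E -> covered D S u v) ->
  weighted_sum U V w w'
    (fun u v => ('X^i * root_poly D).[v - u] * ('X^j * root_poly S).[u + v]) =
  \sum_(q <- E) exception_weight D S w w' q *
     ((q.2 - q.1) ^+ i * (q.1 + q.2) ^+ j).
Proof.
move=> uU uV uE sE cov; rewrite /weighted_sum.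
pose G q := exception_weight D S w w' q * ((q.2 - q.1) ^+ i * (q.1 + q.2) ^+ j).
transitivity (\sum_(u <- U) \sum_(v <- V) G (u, v)).
  apply: eq_bigr => u _; apply: eq_bigr => v _.
  by rewrite /G /exception_weight !hornerM !hornerXn /=; ring.
rewrite -(@big_allpairs _ _ _ _ _ _ _ G) (bigID (mem E)) /=.
rewrite [X in _ + X]big1_seq ?addr0; last first.
  move=> [u v] /= /andP[qE /allpairsP[[u' v'] /= [uU' vV' [Eu Ev]]]].
  move: qE; rewrite Eu Ev => qE.
  rewrite /G /exception_weight /=.
  have /orP[H|H] := cov _ _ uU' vV' qE; move: H; rewrite -root_poly_eq0 => /eqP ->;
    by rewrite !(mul0r, mulr0).
rewrite -big_filter; apply: perm_big; apply: uniq_perm => //.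
  apply/filter_uniq/allpairs_uniq => // [[x y] [x' y']] _ _ /=; by [].
move=> q; rewrite mem_filter /=; case qE: (q \in E) => //=.
apply/allpairsP; exists q; have [H1 H2] := sE _ qE; split=> //.
by case: (q).
Qed.

Section Centred.
(* Every positive even number has the form of k. *)
Variables (m : nat) (U V : seq F).
Local Notation k := m.*2.+2.
Hypotheses (uU : uniq U) (uV : uniq V).
Hypotheses (sU : size U = k.+1) (sV : size V = k.+1).
Hypotheses (U0 : \sum_(u <- U) u = 0) (V0 : \sum_(v <- V) v = 0).

(** The properties of [centred_weights] for the two factors of the grid. *)
Definition moment_weights (w w' : F -> F) :=
  [/\ forall r, (r < k)%N -> \sum_(u <- U) w u * u ^+ r = 0,
      forall r, (r < k)%N -> \sum_(v <- V) w' v * v ^+ r = 0,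
      \sum_(u <- U) w u * u ^+ k = 1 /\ \sum_(v <- V) w' v * v ^+ k = 1,
      \sum_(u <- U) w u * u ^+ k.+1 = 0 /\ \sum_(v <- V) w' v * v ^+ k.+1 = 0
    & \sum_(u <- U) w u * u ^+ k.+2 = (\sum_(u <- U) u ^+ 2) / 2 /\
      \sum_(v <- V) w' v * v ^+ k.+2 = (\sum_(v <- V) v ^+ 2) / 2].

Lemma moment_weights_exist : exists w w', moment_weights w w'.
Proof.
have [w [w0 w1 w2 w3]] := centred_weights (ltn0Sn _) uU sU U0.
have [w' [w0' w1' w2' w3']] := centred_weights (ltn0Sn _) uV sV V0.
by exists w, w'.
Qed.

Local Notation N w w' := (diag_moment U V w w').

(** Evenness of k is what makes the middle moment nonzero and its two
    neighbours zero.  In degree 2k + 2 the moment is a multiple of the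
    difference of the second moments of U and V. *)
Lemma diag_moments_spec w w' : moment_weights w w' ->
  [/\ N w w' k k != 0, N w w' k.+1 k.-1 = 0, N w w' k.-1 k.+1 = 0,
      N w w' k.+2 k.-2 != 0 &
      N w w' k.+1 k.+1 = 0 -> \sum_(u <- U) u ^+ 2 = \sum_(v <- V) v ^+ 2].
Proof.
case=> w0 w0' [w1 w1'] [w2 w2'] [w3 w3'].
have mid := diag_moment_mid w0 w1 w0' w1'.
have [far near] := diag_poly_near_mid_eq0 F m.
split.
- by rewrite mid ?addnn // -doubleS diag_poly_mid_neq0.
- by rewrite mid; last lia.
- by rewrite mid; last lia.
- by rewrite mid ?diag_poly_far_neq0 //=; lia.
rewrite (diag_moment_high w0 w1 w2 w0' w1'); last lia.
have [c c0 [c1 c2]] := diag_poly_next_mid F m.+1.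
rewrite -doubleS c1 c2 !doubleS w3 w3' => /eqP.
rewrite mulNr subr_eq0 => /eqP /(mulfI c0) E; symmetry.
by apply: (mulIf _ E); rewrite invr_eq0 pnatr_eq0.
Qed.

Lemma exception_sum D S E w w' i j a b : moment_weights w w' -> uniq E ->
  (forall q, q \in E -> q.1 \in U /\ q.2 \in V) ->
  (forall u v, u \in U -> v \in V -> (u, v) \notin E -> covered D S u v) ->
  (0 < a)%N -> (0 < b)%N -> (a + b = k.*2)%N ->
  (i + size D <= a.+1)%N -> (j + size S <= b.+1)%N ->
  let p := 'X^i * root_poly D in let q := 'X^j * root_poly S in
  \sum_(q <- E) exception_weight D S w w' q *
     ((q.2 - q.1) ^+ i * (q.1 + q.2) ^+ j) =
  p`_a.+1 * q`_b.+1 * N w w' a.+1 b.+1 + p`_a.+1 * q`_b.-1 * N w w' a.+1 b.-1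
  + p`_a * q`_b * N w w' a b + p`_a.-1 * q`_b.+1 * N w w' a.-1 b.+1.
Proof.
case=> w0 w0' [w1 w1'] [w2 w2'] _ uE sE cov a0 b0 ab iD jS p q.
rewrite -(weighted_sum_exceptions _ _ _ _ uU uV uE sE cov).
apply: (weighted_sum_poly w0 w2 w0' w2') => //.
  by rewrite /p (leq_trans (size_shift_root_poly _ _)) // addnS ltnS.
by rewrite /q (leq_trans (size_shift_root_poly _ _)) // addnS ltnS.
Qed.

(** With om the weight at (a, b), the test functions 1, y - x, x + y and
    (y - x)(x + y) give om = N, om (b - a) = - N sum D, om (a + b) = - N sum S
    and om (b - a)(a + b) = N' + N (sum D)(sum S), where N is the middle moment
    and N' the one of degree 2k + 2; hence N' = 0. *)
Lemma centred_one_exception D S a b : size D = k -> size S = k ->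
  a \in U -> b \in V ->
  (forall u v, u \in U -> v \in V -> (u, v) != (a, b) -> covered D S u v) ->
  [/\ b - a = - \sum_(d <- D) d, a + b = - \sum_(s <- S) s
    & \sum_(u <- U) u ^+ 2 = \sum_(v <- V) v ^+ 2].
Proof.
move=> sD sS aU bV cov.
have [w [w' ww]] := moment_weights_exist.
have [N0 N1 N2 _ N4] := diag_moments_spec ww.
pose om := exception_weight D S w w' (a, b).
have [pD1 pD0] := coef_root_poly sD; have [pS1 pS0] := coef_root_poly sS.
have pD2 : (root_poly D)`_k.+1 = 0 by rewrite nth_default // size_root_poly sD.
have pS2 : (root_poly S)`_k.+1 = 0 by rewrite nth_default // size_root_poly sS.
have EUV q : q \in [:: (a, b)] -> q.1 \in U /\ q.2 \in V.
  by rewrite inE => /eqP ->.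
have covE u v : u \in U -> v \in V -> (u, v) \notin [:: (a, b)] -> covered D S u v.
  by rewrite inE; apply: cov.
have main i j := @exception_sum D S [:: (a, b)] w w' i j k k ww isT EUV covE
  isT isT (addnn _).
have c0 s r : ('X^0 * root_poly s)`_r = (root_poly s)`_r by rewrite expr0 mul1r.
have c1 s r : ('X^1 * root_poly s)`_r.+1 = (root_poly s)`_r.
  exact: (coef_shift_root_poly 1).
have := main 0%N 0%N; have := main 1%N 0%N.
have := main 0%N 1%N; have := main 1%N 1%N.
rewrite !big_seq1 /= -/om sD sS !c0 !c1 pD0 pS0 pD1 pS1 pD2 pS2 N1 N2.
rewrite !(mulr0, mul0r, addr0, add0r, expr0, expr1, mul1r, mulr1).
move=> /(_ (leqnn _) (leqnn _)) E11 /(_ (leqnSn _) (leqnn _)) E01.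
move=> /(_ (leqnn _) (leqnSn _)) E10 /(_ (leqnSn _) (leqnSn _)) E00.
rewrite E00 in E01 E10 E11.
have ba : b - a = - \sum_(d <- D) d by apply: (mulfI N0); rewrite E10 mulrC.
have ab : a + b = - \sum_(s <- S) s by apply: (mulfI N0); rewrite E01 mulrC.
split=> //; apply: N4; move: E11; rewrite ba ab mulrC.
by move=> /esym /eqP; rewrite -subr_eq0 addrK => /eqP.
Qed.

(** The first equation makes the weights opposite; then the points share their
    value of y - x, which forces T = 0, and so s^2 = s'^2 although s <> s'. *)
Lemma two_point_moments (om om' s s' d d' T n n' : F) : n != 0 -> n' != 0 ->
  om + om' = 0 -> om * d + om' * d' = 0 -> om * s + om' * s' = n ->
  om * s ^+ 2 + om' * s' ^+ 2 = - T * n ->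
  om * d ^+ 2 + om' * d' ^+ 2 = - T * n' -> s + s' = 0.
Proof.
move=> n0 n0' /eqP; rewrite addrC addr_eq0 => /eqP ->.
rewrite !mulNr -!mulrBr => dd ss s2 d2.
have : om * (s - s') != 0 by rewrite ss.
rewrite mulf_eq0 negb_or => /andP[om0 ss0].
move/eqP: dd; rewrite mulf_eq0 (negPf om0) subr_eq0 /= => /eqP dd.
move/eqP: d2; rewrite dd subrr mulr0 eq_sym oppr_eq0 mulf_eq0 (negPf n0') orbF.
move=> /eqP T0; move/eqP: s2; rewrite T0 mul0r oppr0 mulf_eq0 (negPf om0) subr_sqr.
by rewrite mulf_eq0 (negPf ss0) /= => /eqP.
Qed.

(** With one antidiagonal fewer the product has degree 2k - 1, so its own
    weighted sum is 0, and test functions of degree 1 and 2 feel only the first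
    two layers of moments. *)
Lemma centred_two_exceptions D S a b a' b' : size D = k -> size S = k.-1 ->
  a \in U -> b \in V -> a' \in U -> b' \in V -> (a, b) != (a', b') ->
  (forall u v, u \in U -> v \in V -> (u, v) != (a, b) -> (u, v) != (a', b') ->
     covered D S u v) ->
  (a + b) + (a' + b') = 0.
Proof.
move=> sD sS aU bV aU' bV' neq cov.
have [w [w' ww]] := moment_weights_exist.
have [N0 N1 N2 N3 _] := diag_moments_spec ww.
pose om := exception_weight D S w w' (a, b).
pose om' := exception_weight D S w w' (a', b').
have [pD1 pD0] := coef_root_poly sD; have [pS1 pS0] := coef_root_poly sS.
have pD2 : (root_poly D)`_k.+1 = 0 by rewrite nth_default // size_root_poly sD.
have pS2 : (root_poly S)`_k = 0 by rewrite nth_default // size_root_poly sS.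
have pS3 : (root_poly S)`_k.+1 = 0 by rewrite nth_default // size_root_poly sS.
have uE : uniq [:: (a, b); (a', b')] by rewrite /= inE neq.
have EUV q : q \in [:: (a, b); (a', b')] -> q.1 \in U /\ q.2 \in V.
  by rewrite !inE => /orP[] /eqP ->.
have covE u v : u \in U -> v \in V -> (u, v) \notin [:: (a, b); (a', b')] ->
    covered D S u v.
  by move=> uin vin; rewrite !inE negb_or => /andP[]; apply: cov.
have main i j c e := @exception_sum D S _ w w' i j c e ww uE EUV covE.
have c0 s r : ('X^0 * root_poly s)`_r = (root_poly s)`_r by rewrite expr0 mul1r.
have c1 s r : ('X^1 * root_poly s)`_r.+1 = (root_poly s)`_r.
  exact: (coef_shift_root_poly 1).
have c2 s r : ('X^2 * root_poly s)`_r.+2 = (root_poly s)`_r.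
  exact: (coef_shift_root_poly 2).
have kk : (k.+1 + k.-1 = k.*2)%N by rewrite addSnnS addnn.
have := main 0%N 0%N k k isT isT (addnn _).
have := main 1%N 0%N k k isT isT (addnn _).
have := main 0%N 1%N k k isT isT (addnn _).
have := main 0%N 2%N k k isT isT (addnn _).
have := main 2%N 0%N k.+1 k.-1 isT isT kk.
rewrite !big_cons !big_nil /= -/om -/om' sD sS !c0 !c1 !c2.
rewrite pD0 pS0 pD1 pS1 pD2 pS2 pS3 N1 N2.
rewrite !(mulr0, mul0r, addr0, add0r, expr0, expr1, mul1r, mulr1).
move=> E20 E02 E01 E10 E00.
exact: (two_point_moments N0 N3 (E00 (leqnSn _) (leqW (leqnSn _)))
  (E10 (leqnn _) (leqW (leqnSn _))) (E01 (leqnSn _) (leqnSn _))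
  (E02 (leqnSn _) (leqnn _)) (E20 (leqnn _) (leqnSn _))).
Qed.
End Centred.

Lemma sum_shift (s : seq F) c :
  \sum_(x <- [seq x - c | x <- s]) x = \sum_(x <- s) x - (size s)%:R * c.
Proof.
rewrite big_map; elim: s => [|x s IH]; first by rewrite !big_nil mul0r subr0.
by rewrite !big_cons IH /= mulrS; ring.
Qed.

Lemma sum_sqr_shift (s : seq F) c :
  \sum_(x <- [seq x - c | x <- s]) x ^+ 2 =
  \sum_(x <- s) x ^+ 2 - (\sum_(x <- s) x) * c *+ 2 + (size s)%:R * c ^+ 2.
Proof.
rewrite big_map; elim: s => [|x s IH].
  by rewrite !big_nil !mul0r mul0rn subrr add0r.
by rewrite !big_cons IH /= mulrS; ring.
Qed.

Lemma covered_shift D S c e u v :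
  covered [seq d - (e - c) | d <- D] [seq s - (e + c) | s <- S] (u - c) (v - e)
  = covered D S u v.
Proof.
have E (t : seq F) f x : (x - f \in [seq y - f | y <- t]) = (x \in t).
  exact: (mem_map (@addIr F (- f))).
rewrite /covered.
have -> : v - e - (u - c) = v - u - (e - c) by ring.
have -> : u - c + (v - e) = u + v - (e + c) by ring.
by rewrite !E.
Qed.

Section Uncentred.
Variables (m : nat) (U V : seq F).
Local Notation k := m.*2.+2.
Hypotheses (uU : uniq U) (uV : uniq V).
Hypotheses (sU : size U = k.+1) (sV : size V = k.+1).

Let mean (s : seq F) := (\sum_(x <- s) x) / k.+1%:R.
Let centre s := [seq x - mean s | x <- s].

Lemma centre_uniq s : uniq s -> uniq (centre s).
Proof. by rewrite map_inj_uniq //; apply: addIr. Qed.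

Lemma centre_sum s : size s = k.+1 -> \sum_(x <- centre s) x = 0.
Proof.
by move=> ss; rewrite sum_shift ss /mean mulrC divfK ?subrr // pnatr_eq0.
Qed.

Lemma centre_sum_sqr s : size s = k.+1 ->
  k.+1%:R * \sum_(x <- centre s) x ^+ 2 =
  k.+1%:R * \sum_(x <- s) x ^+ 2 - (\sum_(x <- s) x) ^+ 2.
Proof.
move=> ss; have k0 : k.+1%:R != 0 :> F by rewrite pnatr_eq0.
rewrite sum_sqr_shift ss; set t := \sum_(x <- s) x.
have -> : mean s = t / k.+1%:R by [].
by move: (k.+1%:R : F) k0 => K K0; field.
Qed.

Lemma centre_mem s x : (x - mean s \in centre s) = (x \in s).
Proof. exact: (mem_map (@addIr F (- mean s))). Qed.

Lemma centre_cover D S (P : F -> F -> bool) :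
  (forall u v, u \in U -> v \in V -> P u v -> covered D S u v) ->
  forall u v, u \in centre U -> v \in centre V -> P (u + mean U) (v + mean V) ->
  covered [seq d - (mean V - mean U) | d <- D] [seq s - (mean V + mean U) | s <- S]
    u v.
Proof.
move=> cov _ _ /mapP[u uU' ->] /mapP[v vV' ->]; rewrite !subrK => Puv.
by rewrite covered_shift; apply: cov.
Qed.

(** The third conclusion is the equality of the variances of U and V. *)
Lemma one_exception D S a b : size D = k -> size S = k ->
  a \in U -> b \in V ->
  (forall u v, u \in U -> v \in V -> (u, v) != (a, b) -> covered D S u v) ->
  [/\ b - a = \sum_(v <- V) v - \sum_(u <- U) u - \sum_(d <- D) d,
      a + b = \sum_(u <- U) u + \sum_(v <- V) v - \sum_(s <- S) s &
      k.+1%:R * \sum_(u <- U) u ^+ 2 - (\sum_(u <- U) u) ^+ 2 =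
      k.+1%:R * \sum_(v <- V) v ^+ 2 - (\sum_(v <- V) v) ^+ 2].
Proof.
move=> sD sS aU bV cov.
have := @centred_one_exception m (centre U) (centre V) (centre_uniq uU)
  (centre_uniq uV) _ _ (centre_sum sU) (centre_sum sV)
  [seq d - (mean V - mean U) | d <- D] [seq s - (mean V + mean U) | s <- S]
  (a - mean U) (b - mean V).
rewrite !size_map !centre_mem => /(_ sU sV sD sS aU bV) [|ba ab sq].
  move=> u v uin vin neq.
  apply: (centre_cover (P := fun u v => (u, v) != (a, b))) => //.
  by apply: contraNneq neq => -[<- <-]; rewrite !addrK.
rewrite -!centre_sum_sqr // sq; split=> //.
  have k0 : k.+1%:R != 0 :> F by rewrite pnatr_eq0.
  have kK : k%:R = k.+1%:R - 1 :> F by rewrite -[k.+1]addn1 natrD addrK.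
  move: ba; rewrite sum_shift sD /mean => /eqP.
  rewrite -subr_eq0 => /eqP E; apply/eqP; rewrite -subr_eq0 -[X in _ == X]E.
  by apply/eqP; rewrite kK; move: (k.+1%:R : F) k0 => K K0; field.
have k0 : k.+1%:R != 0 :> F by rewrite pnatr_eq0.
have kK : k%:R = k.+1%:R - 1 :> F by rewrite -[k.+1]addn1 natrD addrK.
move: ab; rewrite sum_shift sS /mean => /eqP.
rewrite -subr_eq0 => /eqP E; apply/eqP; rewrite -subr_eq0 -[X in _ == X]E.
by apply/eqP; rewrite kK; move: (k.+1%:R : F) k0 => K K0; field.
Qed.

Lemma two_exceptions D S a b a' b' : size D = k -> size S = k.-1 ->
  a \in U -> b \in V -> a' \in U -> b' \in V -> (a, b) != (a', b') ->
  (forall u v, u \in U -> v \in V -> (u, v) != (a, b) -> (u, v) != (a', b') ->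
     covered D S u v) ->
  k.+1%:R * ((a + b) + (a' + b')) =
  (\sum_(u <- U) u + \sum_(v <- V) v) *+ 2.
Proof.
move=> sD sS aU bV aU' bV' neq cov.
have := @centred_two_exceptions m (centre U) (centre V) (centre_uniq uU)
  (centre_uniq uV) _ _ (centre_sum sU) (centre_sum sV)
  [seq d - (mean V - mean U) | d <- D] [seq s - (mean V + mean U) | s <- S]
  (a - mean U) (b - mean V) (a' - mean U) (b' - mean V).
rewrite !size_map !centre_mem => /(_ sU sV sD sS aU bV aU' bV') H.
have k0 : k.+1%:R != 0 :> F by rewrite pnatr_eq0.
have /eqP : a - mean U + (b - mean V) + (a' - mean U + (b' - mean V)) = 0.
  apply: H => [|u v uin vin n1 n2].
    by apply: contraNneq neq => -[/addIr -> /addIr ->].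
  apply: (centre_cover
    (P := fun u v => ((u, v) != (a, b)) && ((u, v) != (a', b')))) => //.
    by move=> x y xU yV /andP[]; apply: cov.
  apply/andP; split; [apply: contraNneq n1 | apply: contraNneq n2] => -[<- <-];
    by rewrite !addrK.
rewrite -(inj_eq (mulfI k0)) mulr0 => /eqP E.
apply/eqP; rewrite -subr_eq0 -[X in _ == X]E; apply/eqP.
by rewrite /mean; move: (k.+1%:R : F) k0 => K K0; field.
Qed.
End Uncentred.
End Exceptions.

Section IntegerExceptions.
Variables (m : nat) (U V : seq int).
Local Notation k := m.*2.+2.
Local Notation toQ s := [seq x%:~R : rat | x <- s].
Hypotheses (uU : uniq U) (uV : uniq V).
Hypotheses (sU : size U = k.+1) (sV : size V = k.+1).

Lemma toQ_mem s x : (x%:~R \in toQ s) = (x \in s).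
Proof. exact: (mem_map (@intr_inj rat)). Qed.

Lemma toQ_uniq s : uniq (toQ s) = uniq s.
Proof. exact: (map_inj_uniq (@intr_inj rat)). Qed.

Lemma toQ_sum s : \sum_(x <- toQ s) x = (\sum_(x <- s) x)%:~R.
Proof. by rewrite big_map rmorph_sum. Qed.

Lemma toQ_sum_sqr s : \sum_(x <- toQ s) x ^+ 2 = (\sum_(x <- s) x ^+ 2)%:~R.
Proof.
by rewrite big_map rmorph_sum; apply: eq_bigr => x _; rewrite rmorphXn.
Qed.

Lemma toQ_covered D S u v :
  covered (toQ D) (toQ S) u%:~R v%:~R = covered D S u v.
Proof. by rewrite /covered -intrB -intrD !toQ_mem. Qed.

Lemma int_one_exception D S a b : size D = k -> size S = k ->
  a \in U -> b \in V ->
  (forall u v, u \in U -> v \in V -> (u, v) != (a, b) -> covered D S u v) ->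
  [/\ b - a = \sum_(v <- V) v - \sum_(u <- U) u - \sum_(d <- D) d,
      a + b = \sum_(u <- U) u + \sum_(v <- V) v - \sum_(s <- S) s &
      k.+1%:Z * \sum_(u <- U) u ^+ 2 - (\sum_(u <- U) u) ^+ 2 =
      k.+1%:Z * \sum_(v <- V) v ^+ 2 - (\sum_(v <- V) v) ^+ 2].
Proof.
move=> sD sS aU bV cov.
have := @one_exception _ m (toQ U) (toQ V) _ _ _ _ (toQ D) (toQ S) a%:~R b%:~R.
rewrite !toQ_uniq !size_map !toQ_mem.
move=> /(_ uU uV sU sV sD sS aU bV)[|].
  move=> _ _ /mapP[u uin ->] /mapP[v vin ->] neq; rewrite toQ_covered cov //.
  by apply: contraNneq neq => -[-> ->].
rewrite !toQ_sum !toQ_sum_sqr => E1 E2 E3; split; apply: (@intr_inj rat).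
- by rewrite !(intrB, intrD) E1.
- by rewrite !(intrB, intrD) E2.
by move: E3; rewrite !(intrB, intrM, rmorphXn (intmul 1)).
Qed.

Lemma int_two_exceptions D S a b a' b' : size D = k -> size S = k.-1 ->
  a \in U -> b \in V -> a' \in U -> b' \in V -> (a, b) != (a', b') ->
  (forall u v, u \in U -> v \in V -> (u, v) != (a, b) -> (u, v) != (a', b') ->
     covered D S u v) ->
  k.+1%:Z * ((a + b) + (a' + b')) =
  (\sum_(u <- U) u + \sum_(v <- V) v) *+ 2.
Proof.
move=> sD sS aU bV aU' bV' neq cov.
have := @two_exceptions _ m (toQ U) (toQ V) _ _ _ _ (toQ D) (toQ S)
  a%:~R b%:~R a'%:~R b'%:~R.
rewrite !toQ_uniq !size_map !toQ_mem.
move=> /(_ uU uV sU sV sD sS aU bV aU' bV') H; apply: (@intr_inj rat).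
rewrite rmorphMn /= !(intrD, intrM) -!toQ_sum; apply: H.
  by apply: contraNneq neq => -[/intr_inj -> /intr_inj ->].
move=> _ _ /mapP[u uin ->] /mapP[v vin ->] n1 n2; rewrite toQ_covered cov //.
  by apply: contraNneq n1 => -[-> ->].
by apply: contraNneq n2 => -[-> ->].
Qed.
End IntegerExceptions.

(** * The border of the bounding box *)

Section Lists.

Lemma uniq_subset_perm (T : eqType) (s t : seq T) : uniq s -> {subset s <= t} ->
  exists r, perm_eq t (s ++ r).
Proof.
elim: s t => [|x s IH] t /=; first by exists t.
move=> /andP[xs us] st; have xt : x \in t by rewrite st ?mem_head.
have [y ys|r pr] := IH (rem x t) us.
  have : y \in t by rewrite st // inE ys orbT.
  rewrite (perm_mem (perm_to_rem xt)) inE => /orP[/eqP yx|//].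
  by rewrite yx (negPf xs) in ys.
by exists r; rewrite (permPl (perm_to_rem xt)) perm_cons.
Qed.

(** The flag c tells whether the point x of s may be missing from t. *)
Lemma uniq_leq_size_but_one (T : eqType) (s t : seq T) (c : bool) x : uniq s ->
  (forall y, y \in s -> ~~ (c && (y == x)) -> y \in t) ->
  (size s <= size t + c)%N.
Proof.
move=> us; case: c => /= st; last first.
  by rewrite addn0; apply: uniq_leq_size => // y ys; apply: st.
have : (size (rem x s) <= size t)%N.
  apply: uniq_leq_size; first exact: rem_uniq.
  by move=> y; rewrite (mem_rem_uniq _ us) !inE => /andP[yx ys]; apply: st.
by case: (boolP (x \in s)) => [/size_rem ->|/rem_id ->]; lia.
Qed.

Lemma count_disjoint (T : Type) (p q : pred T) s :
  (forall x, p x -> ~~ q x) -> (count p s + count q s <= size s)%N.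
Proof.
move=> pq; rewrite -count_predUI [X in (_ + X)%N](eq_count (a2 := pred0)).
  by rewrite count_pred0 addn0 count_size.
by move=> x /=; apply/negbTE/andP => -[/pq/negP].
Qed.

(** Two ranges of lines that share only the line c. *)
Lemma count_overlap (T : eqType) (p q : pred T) c s : uniq s ->
  (forall x, p x -> q x -> x = c) -> (count p s + count q s <= (size s).+1)%N.
Proof.
move=> us pq; rewrite -count_predUI -addn1 leq_add ?count_size //.
apply: leq_trans (_ : count (pred1 c) s <= 1)%N.
  by apply: sub_count => x /= /andP[px qx]; apply/eqP/pq.
by rewrite count_uniq_mem //; case: (_ \in _).
Qed.

(** When the count of [count_overlap] is attained, the two ranges exhaust s and
    c is in s. *)
Lemma sum_overlap (p q : pred int) (c : int) (s : seq int) (f : int -> int) :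
  uniq s ->
  (forall x, p x && q x = (x == c)) -> (size s < count p s + count q s)%N ->
  \sum_(x <- s | p x) f x + \sum_(x <- s | q x) f x = \sum_(x <- s) f x + f c.
Proof.
move=> us pq; rewrite -count_predUI.
have := count_size (predU p q) s.
have -> : count (predI p q) s = count (pred1 c) s by apply: eq_count => x; apply: pq.
rewrite (count_uniq_mem _ us) => le1 le2.
have cs : c \in s by move: le2; case: (c \in s); rewrite // addn0 ltnNge le1.
have : count (predU p q) s == size s.
  by rewrite eqn_leq le1; move: le2; rewrite cs addn1 ltnS.
rewrite -all_count => /allP all_pq.
have E : \sum_(x <- s | p x) f x + \sum_(x <- s | q x) f x =
    \sum_(x <- s | predU p q x) f x + \sum_(x <- s | predI p q x) f x.
  elim: (s) => [|x t IH]; first by rewrite !big_nil.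
  move: IH; rewrite !big_cons /=; case: (p x); case: (q x) => /=; lia.
rewrite E; congr (_ + _).
  by rewrite big_seq_cond [RHS]big_seq; apply: eq_bigl => x;
    case xs: (x \in s) => //=; have /= -> := all_pq _ xs.
rewrite -big_filter (eq_filter (a2 := pred1 c)) => [|x /=]; last exact: pq.
by rewrite filter_pred1_uniq // big_seq1.
Qed.

Lemma seq_bounds (s : seq int) : s != [::] ->
  exists x0 x1, [/\ x0 \in s, x1 \in s & forall x, x \in s -> x0 <= x <= x1].
Proof.
elim: s => // x s IH _; case: (eqVneq s [::]) => [->|/IH [x0 [x1 [s0 s1 sb]]]].
  by exists x, x; rewrite mem_head; split=> // y; rewrite inE => /eqP ->; lia.
exists (if x0 <= x then x0 else x), (if x <= x1 then x1 else x).
split.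
- by case: ifP; rewrite inE ?s0 ?eqxx ?orbT.
- by case: ifP; rewrite inE ?s1 ?eqxx ?orbT.
by move=> y; rewrite inE => /orP[/eqP ->|/sb]; have := sb _ s0;
  case: ifP; case: ifP; lia.
Qed.

End Lists.

(** In a box wider than high no line of slope 1 or -1 meets both vertical
    sides, so the 2k lines hit at most 2k of the points on these sides; at
    least 2k + 1 need to be hit, as the exception is on one side at most. *)
Lemma covered_width_le k (U V D S : seq int) (a b x0 x1 y0 y1 : int) :
  uniq V -> (k < size V)%N -> (size D <= k)%N -> (size S <= k)%N ->
  (forall u v : int, u \in U -> v \in V -> (u, v) != (a, b) ->
     covered D S u v) ->
  (0 < k)%N -> x0 \in U -> x1 \in U ->
  (forall v : int, v \in V -> y0 <= v <= y1) ->
  x1 - x0 <= y1 - y0.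
Proof.
move=> uV sV sD sS cov k0 x0U x1U Vb; rewrite leNgt; apply/negP => wide.
pose onD (x d : int) := y0 <= d + x <= y1.
pose onS (x s : int) := y0 <= s - x <= y1.
pose hits x := [seq d + x | d <- filter (onD x) D] ++
               [seq s - x | s <- filter (onS x) S].
have hit (x v : int) : v \in V -> covered D S x v -> v \in hits x.
  move=> vV /orP[dD|sS']; rewrite mem_cat.
    apply/orP; left; apply/mapP; exists (v - x); last by rewrite subrK.
    by rewrite mem_filter /onD subrK Vb.
  apply/orP; right; apply/mapP; exists (x + v); last by lia.
  by rewrite mem_filter /onS (_ : x + v - x = v) ?Vb //; lia.
have size_hits x : x \in U -> (size V <= size (hits x) + (a == x))%N.
  move=> xU; apply: (@uniq_leq_size_but_one _ _ _ _ b) => // v vV nv.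
  apply: hit => //; apply: cov => //; apply: contra nv => /eqP [<- <-].
  by rewrite !eqxx.
move: (size_hits x0 x0U) (size_hits x1 x1U).
rewrite !size_cat !size_map !size_filter.
have HD : (count (onD x0) D + count (onD x1) D <= size D)%N.
  by apply: count_disjoint => d; rewrite /onD; lia.
have HS : (count (onS x0) S + count (onS x1) S <= size S)%N.
  by apply: count_disjoint => s; rewrite /onS; lia.
have [v vV] : exists v, v \in V.
  by case: (V) sV => // v V' _; exists v; rewrite mem_head.
have y01 := Vb v vV.
case: (eqVneq a x0) => [->|_]; case: (eqVneq _ x1) => [E|_] /=; lia.
Qed.

(** In a square box with lower left corner (x0, y0) and side W, the ranges
    [above] and [below] of diagonals share the main diagonal, and the ranges
    [low] and [high] of antidiagonals share the main antidiagonal.  Lines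
    [above] run from the left side to the top, [below] from the bottom to the
    right side, [low] from the left side to the bottom, and [high] from the top
    to the right side.  The lists of hits are the points where they arrive. *)
Section Square.
Variables (D S : seq int) (x0 y0 W : int).

Definition above (d : int) := 0 <= d - (y0 - x0) <= W.
Definition below (d : int) := - W <= d - (y0 - x0) <= 0.
Definition low (s : int) := 0 <= s - (x0 + y0) <= W.
Definition high (s : int) := W <= s - (x0 + y0) <= W + W.

Definition left_hits :=
  [seq d + x0 | d <- filter above D] ++ [seq s - x0 | s <- filter low S].
Definition right_hits :=
  [seq d + (x0 + W) | d <- filter below D] ++
  [seq s - (x0 + W) | s <- filter high S].
Definition bottom_hits :=
  [seq y0 - d | d <- filter below D] ++ [seq s - y0 | s <- filter low S].
Definition top_hits :=
  [seq y0 + W - d | d <- filter above D] ++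
  [seq s - (y0 + W) | s <- filter high S].

Lemma left_hit (v : int) :
  y0 <= v <= y0 + W -> covered D S x0 v -> v \in left_hits.
Proof.
move=> vb /orP[dD|sS]; rewrite mem_cat; apply/orP; [left|right]; apply/mapP.
  by exists (v - x0); [rewrite mem_filter dD andbT /above | ]; lia.
by exists (x0 + v); [rewrite mem_filter sS andbT /low | ]; lia.
Qed.

Lemma right_hit (v : int) :
  y0 <= v <= y0 + W -> covered D S (x0 + W) v -> v \in right_hits.
Proof.
move=> vb /orP[dD|sS]; rewrite mem_cat; apply/orP; [left|right]; apply/mapP.
  by exists (v - (x0 + W)); [rewrite mem_filter dD andbT /below | ]; lia.
by exists (x0 + W + v); [rewrite mem_filter sS andbT /high | ]; lia.
Qed.

Lemma bottom_hit (u : int) :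
  x0 <= u <= x0 + W -> covered D S u y0 -> u \in bottom_hits.
Proof.
move=> ub /orP[dD|sS]; rewrite mem_cat; apply/orP; [left|right]; apply/mapP.
  by exists (y0 - u); [rewrite mem_filter dD andbT /below | ]; lia.
by exists (u + y0); [rewrite mem_filter sS andbT /low | ]; lia.
Qed.

Lemma top_hit (u : int) :
  x0 <= u <= x0 + W -> covered D S u (y0 + W) -> u \in top_hits.
Proof.
move=> ub /orP[dD|sS]; rewrite mem_cat; apply/orP; [left|right]; apply/mapP.
  by exists (y0 + W - u); [rewrite mem_filter dD andbT /above | ]; lia.
by exists (u + (y0 + W)); [rewrite mem_filter sS andbT /high | ]; lia.
Qed.

Lemma size_hits :
  [/\ size left_hits = (count above D + count low S)%N,
      size right_hits = (count below D + count high S)%N,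
      size bottom_hits = (count below D + count low S)%N
    & size top_hits = (count above D + count high S)%N].
Proof. by rewrite !size_cat !size_map !size_filter. Qed.

Lemma count_above_below :
  uniq D -> (count above D + count below D <= (size D).+1)%N.
Proof.
move=> uD; apply: (@count_overlap int _ _ (y0 - x0)) => // d.
by rewrite /above /below; lia.
Qed.

Lemma count_low_high :
  uniq S -> (count low S + count high S <= (size S).+1)%N.
Proof.
move=> uS; apply: (@count_overlap int _ _ (x0 + y0 + W)) => // s.
by rewrite /low /high; lia.
Qed.

End Square.

(** If every border point is covered, then with p, q the numbers of diagonals
    above and below and r, t those of antidiagonals low and high,
    p + r, q + t, q + r and p + t are at least k + 1, while p + q and r + t are
    at most k + 1.  So p = q and 2p = k + 1, and k is odd. *)
Lemma exception_on_border k (U V D S : seq int) (a b x0 y0 W : int) :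
  ~~ odd k -> [/\ uniq U, uniq V, uniq D & uniq S] ->
  [/\ (k < size U)%N, (k < size V)%N, (size D <= k)%N & (size S <= k)%N] ->
  (forall u v : int, u \in U -> v \in V -> (u, v) != (a, b) ->
     covered D S u v) ->
  x0 \in U -> x0 + W \in U -> (forall u : int, u \in U -> x0 <= u <= x0 + W) ->
  y0 \in V -> y0 + W \in V -> (forall v : int, v \in V -> y0 <= v <= y0 + W) ->
  [|| a == x0, a == x0 + W, b == y0 | b == y0 + W].
Proof.
move=> ek [uU uV uD uS] [sU sV sD sS] cov x0U x1U Ub y0V y1V Vb.
apply/negPn/negP; rewrite !negb_or => /and4P[a0 a1 b0 b1].
have neq (x y : int) : (x != a) || (y != b) -> (x, y) != (a, b).
  by apply: contraL => /eqP[-> ->]; rewrite !eqxx.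
have hl : (size V <= size (left_hits D S x0 y0 W))%N.
  apply: uniq_leq_size => // v vV; apply: (left_hit (Vb v vV)).
  by apply: cov => //; rewrite neq // eq_sym a0.
have hr : (size V <= size (right_hits D S x0 y0 W))%N.
  apply: uniq_leq_size => // v vV; apply: (right_hit (Vb v vV)).
  by apply: cov => //; rewrite neq // eq_sym a1.
have hb : (size U <= size (bottom_hits D S x0 y0 W))%N.
  apply: uniq_leq_size => // u uin; apply: (bottom_hit (Ub u uin)).
  by apply: cov => //; rewrite neq // [y0 == _]eq_sym b0 orbT.
have ht : (size U <= size (top_hits D S x0 y0 W))%N.
  apply: uniq_leq_size => // u uin; apply: (top_hit (Ub u uin)).
  by apply: cov => //; rewrite neq // [y0 + W == _]eq_sym b1 orbT.
have [sl sr sb st] := size_hits D S x0 y0 W; rewrite sl sr sb st in hl hr hb ht.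
move: (count_above_below x0 y0 W uD) (count_low_high x0 y0 W uS).
by move: hl hr hb ht ek sU sV sD sS; clear; lia.
Qed.

Lemma covering_box k (U V D S : seq int) (a b : int) : (0 < k)%N -> ~~ odd k ->
  [/\ uniq U, uniq V, uniq D & uniq S] ->
  [/\ (k < size U)%N, (k < size V)%N, (size D <= k)%N & (size S <= k)%N] ->
  (forall u v : int, u \in U -> v \in V -> (u, v) != (a, b) ->
     covered D S u v) ->
  exists x0 y0 W : int, [/\ 0 < W,
    [/\ x0 \in U, x0 + W \in U & forall u : int, u \in U -> x0 <= u <= x0 + W],
    [/\ y0 \in V, y0 + W \in V & forall v : int, v \in V -> y0 <= v <= y0 + W]
    & [|| a == x0, a == x0 + W, b == y0 | b == y0 + W]].
Proof.
move=> k0 ek [uU uV uD uS] [sU sV sD sS] cov.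
have U0 : U != [::] by apply: contraTneq sU => ->.
have V0 : V != [::] by apply: contraTneq sV => ->.
have [x0 [x1 [x0U x1U Ub]]] := seq_bounds U0.
have [y0 [y1 [y0V y1V Vb]]] := seq_bounds V0.
have le1 := covered_width_le uV sV sD sS cov k0 x0U x1U Vb.
have le2 : y1 - y0 <= x1 - x0.
  have sD' : (size [seq - d | d <- D] <= k)%N by rewrite size_map.
  apply: (covered_width_le (a := b) (b := a) uU sU sD' sS _ k0 y0V y1V Ub).
  move=> v u vV uU' neq; rewrite /covered -opprB mem_map; last exact: oppr_inj.
  by rewrite [v + u]addrC; apply: cov => //; apply: contraNneq neq => -[-> ->].
have Ex : x1 = x0 + (x1 - x0) by ring.
have Ey : y1 = y0 + (x1 - x0) by move: le1 le2; clear; lia.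
have W0 : 0 < x1 - x0.
  have [t tU tx] : exists2 t, t \in U & t != x0.
    case: (U) uU sU => [|t [|t' U']] //=; first by case: (k) k0.
    rewrite inE negb_or => /andP[/andP[tt _] _] _.
    have [E|tx] := eqVneq t x0; last by exists t; rewrite ?mem_head.
    by exists t'; rewrite ?inE ?eqxx ?orbT // -E eq_sym.
  by move: (Ub t tU) tx; clear; lia.
rewrite Ex in x1U Ub; rewrite Ey in y1V Vb.
exists x0, y0, (x1 - x0); split=> //.
exact: (exception_on_border ek _ _ cov x0U x1U Ub y0V y1V Vb).
Qed.

(** A full cover has an exception wherever one likes, for instance off the
    columns of U and off the rows of V. *)
Lemma no_full_cover k (U V D S : seq int) : (0 < k)%N -> ~~ odd k ->
  [/\ uniq U, uniq V, uniq D & uniq S] ->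
  [/\ (k < size U)%N, (k < size V)%N, (size D <= k)%N & (size S <= k)%N] ->
  ~ (forall u v : int, u \in U -> v \in V -> covered D S u v).
Proof.
move=> k0 ek uq sz cov; case: (sz) => [sU sV _ _].
have fresh (s : seq int) : (k < size s)%N -> exists x, x \notin s.
  case: s => // y s _; have [//|z [x1 [_ _ xb]]] := @seq_bounds (y :: s).
  by exists (x1 + 1); apply/negP => H; have := xb _ H; clear; lia.
have [a aU] := fresh _ sU; have [b bV] := fresh _ sV.
have [|x0 [y0 [W [_ [x0U x1U _] [y0V y1V _]]]]] :=
  @covering_box k U V D S a b k0 ek uq sz.
  by move=> u v uU vV _; apply: cov.
by case/or4P => /eqP E; [move: aU | move: aU | move: bV | move: bV];
  rewrite E ?x0U ?x1U ?y0V ?y1V.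
Qed.

(** * One exception on the border *)

Lemma small_multiple (n t w : int) : 0 < w < n -> n * t <> w /\ n * t <> - w.
Proof.
move=> wn; have [t0|t0] := lerP t (-1); last have [t1|t1] := lerP 1 t.
- by have : n * t <= n * -1; [rewrite ler_pM2l //; lia | lia].
- by have : n * 1 <= n * t; [rewrite ler_pM2l //; lia | lia].
by have -> : t = 0; [lia | rewrite mulr0; lia].
Qed.

Section NearCovers.
Variable m : nat.
Local Notation k := m.*2.+2.

(** What is left of a placement with one lonely queen (a, b): U and V are the
    columns and rows that are not full, D and S the full diagonals and
    antidiagonals.  The sums of D and S are those found by counting queens. *)
Record near_cover (U V D S : seq int) (a b : int) : Prop := NearCover {
  nc_uniq : [/\ uniq U, uniq V, uniq D & uniq S];
  nc_size : [/\ size U = k.+1, size V = k.+1, size D = k & size S = k];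
  nc_mem : a \in U /\ b \in V;
  nc_cov : forall u v : int, u \in U -> v \in V -> (u, v) != (a, b) ->
    covered D S u v;
  nc_sumD : \sum_(d <- D) d = \sum_(u <- U) u - \sum_(v <- V) v;
  nc_sumS : \sum_(s <- S) s = - (\sum_(u <- U) u + \sum_(v <- V) v);
  nc_board : (forall u : int, u \in U -> `|u| <= k%:Z) /\
             (forall v : int, v \in V -> `|v| <= k%:Z) }.

Lemma sum_opp (s : seq int) :
  \sum_(x <- [seq - x | x <- s]) x = - \sum_(x <- s) x.
Proof. by rewrite big_map sumrN. Qed.

Lemma mem_opp (s : seq int) x : (x \in [seq - y | y <- s]) = (- x \in s).
Proof. by rewrite -{1}(opprK x) mem_map //; apply: oppr_inj. Qed.

Lemma uniq_opp (s : seq int) : uniq [seq - y | y <- s] = uniq s.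
Proof. by rewrite map_inj_uniq //; apply: oppr_inj. Qed.

(** Reflecting x exchanges diagonals and antidiagonals. *)
Lemma near_cover_reflect U V D S a b : near_cover U V D S a b ->
  near_cover [seq - u | u <- U] V S D (- a) b.
Proof.
case=> [[uU uV uD uS] [sU sV sD sS] [aU bV] cov eD eS [bU bB]].
split; rewrite ?uniq_opp ?size_map ?sum_opp ?mem_opp ?opprK //.
- move=> u v; rewrite mem_opp => uU' vV neq.
  have := cov (- u) v uU' vV; rewrite /covered orbC [v - u]addrC.
  rewrite opprK [v + u]addrC; apply.
  by apply: contraNneq neq => -[<- <-]; rewrite opprK.
- by rewrite eS; ring.
- by rewrite eD; ring.
by split=> // u; rewrite mem_opp => /bU; rewrite normrN.
Qed.

Lemma near_cover_swap U V D S a b : near_cover U V D S a b ->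
  near_cover V U [seq - d | d <- D] S b a.
Proof.
case=> [[uU uV uD uS] [sU sV sD sS] [aU bV] cov eD eS [bU bB]].
split; rewrite ?uniq_opp ?size_map ?sum_opp //.
- move=> v u vV uU' neq; rewrite /covered mem_opp opprB [v + u]addrC.
  by apply: cov => //; apply: contraNneq neq => -[-> ->].
- by rewrite eD; ring.
by rewrite eS; ring.
Qed.


Lemma near_cover_uncovered U V D S a b : near_cover U V D S a b ->
  ~~ covered D S a b.
Proof.
case=> [uq [sU sV sD sS] _ cov _ _ _]; apply/negP => cab.
have [] := @no_full_cover k U V D S; rewrite ?sU ?sV ?sD ?sS //=.
  by rewrite odd_double.
move=> u v uU vV; have [[-> ->] //|neq] := eqVneq (u, v) (a, b); exact: cov.
Qed.

Lemma near_cover_moments U V D S a b : near_cover U V D S a b ->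
  [/\ a = (\sum_(u <- U) u) *+ 2, b = (\sum_(v <- V) v) *+ 2 &
      k.+1%:Z * \sum_(u <- U) u ^+ 2 - (\sum_(u <- U) u) ^+ 2 =
      k.+1%:Z * \sum_(v <- V) v ^+ 2 - (\sum_(v <- V) v) ^+ 2].
Proof.
case=> [[uU uV _ _] [sU sV sD sS] [aU bV] cov eD eS _].
have [E1 E2 E3] := int_one_exception uU uV sU sV sD sS aU bV cov.
by split=> //; move: E1 E2; rewrite eD eS; clear; lia.
Qed.

Section Box.
Variables (U V D S : seq int) (a b W y0 : int).
Hypothesis nc : near_cover U V D S a b.
Hypothesis W0 : 0 < W.
Hypothesis aWU : a + W \in U.
Hypotheses (Ub : forall u : int, u \in U -> a <= u <= a + W).
Hypotheses (y0V : y0 \in V) (y1V : y0 + W \in V).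
Hypothesis (Vb : forall v : int, v \in V -> y0 <= v <= y0 + W).

Lemma box_width : W <= k%:Z + k%:Z.
Proof.
have [aU _] := nc_mem nc; have [bU _] := nc_board nc.
by move: (bU _ aU) (bU _ aWU); clear; lia.
Qed.

(** The main diagonal would cover (a, b), so the upper right corner is covered
    by the antidiagonal through it, which meets the box nowhere else.  Without
    it the corner becomes a second exception. *)
Lemma no_corner_exception : b <> y0.
Proof.
move=> Eb; have [uU uV uD uS] := nc_uniq nc; have [sU sV sD sS] := nc_size nc.
have [aU bV] := nc_mem nc; have bWV : b + W \in V by rewrite Eb.
have Vb' : forall v : int, v \in V -> b <= v <= b + W by rewrite Eb.
have := near_cover_uncovered nc; rewrite negb_or => /andP[dD _].
have neq : (a, b) != (a + W, b + W).
  by apply/eqP => -[E _]; move: E W0; clear; lia.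
have tr : (a + W) + (b + W) \in S.
  have := nc_cov nc aWU bWV; rewrite eq_sym neq => /(_ isT) /orP[|//].
  by rewrite (_ : b + W - (a + W) = b - a) ?(negPf dD) //; ring.
have sS' : size (rem ((a + W) + (b + W)) S) = k.-1 by rewrite size_rem // sS.
have cov2 (u v : int) : u \in U -> v \in V -> (u, v) != (a, b) ->
    (u, v) != (a + W, b + W) -> covered D (rem ((a + W) + (b + W)) S) u v.
  move=> uin vin n1 n2; have := nc_cov nc uin vin n1.
  rewrite /covered => /orP[->//|uvS]; rewrite (mem_rem_uniq _ uS) !inE uvS andbT.
  apply/orP; right; apply: contraNneq n2 => Euv; apply/eqP.
  have := Ub uin; have := Vb' v vin; move: Euv; clear => *; congr (_, _); lia.
have := int_two_exceptions uU uV sU sV sD sS' aU bV aWU bWV neq cov2.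
have [Ea Eb' _] := near_cover_moments nc.
(* The two exceptions give 2(k + 1)(a + b + W) = a + b, that is
   (2k + 1)(a + b + W) = - W. *)
have : 0 < W < k%:Z + k%:Z + 1 by rewrite W0; move: box_width; clear; lia.
move=> /(small_multiple (a + b + W)) [_]; move: Ea Eb'.
move: (\sum_(u <- U) u) (\sum_(v <- V) v) => P Q Ea Eb' N1 E1; apply: N1.
have -> : k%:Z + k%:Z + 1 = k.+1%:Z *+ 2 - 1 by clear; lia.
have E2 : k.+1%:Z * (a + b + W) *+ 2 = a + b.
  by rewrite [in RHS]Ea [in RHS]Eb' -mulrnDl -E1; ring.
by rewrite mulrBl mul1r mulrnAl E2; ring.
Qed.

Let above' := above a y0 W.
Let below' := below a y0 W.
Let low' := low a y0 W.
Let high' := high a y0 W.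

(** As in [exception_on_border], but the left side may be hit once less.  With
    k = 2m + 2 even, this leaves only one distribution of the lines. *)
Lemma side_hits : b <> y0 -> b <> y0 + W ->
  [/\ perm_eq (left_hits D S a y0 W) (rem b V),
      exists z, perm_eq (right_hits D S a y0 W) (z :: V),
      perm_eq (bottom_hits D S a y0 W) U /\ perm_eq (top_hits D S a y0 W) U,
      count above' D = m.+1 /\ count below' D = m.+2
    & count low' S = m.+1 /\ count high' S = m.+2].
Proof.
move=> b0 b1; have [uU uV uD uS] := nc_uniq nc; have [sU sV sD sS] := nc_size nc.
have [aU bV] := nc_mem nc; have cov := nc_cov nc.
have [| |rl prl] := @uniq_subset_perm _ (rem b V) (left_hits D S a y0 W).
- exact: rem_uniq.
- move=> v; rewrite (mem_rem_uniq _ uV) !inE => /andP[vb vV].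
  apply: (left_hit (Vb vV)); apply: cov => //.
  by apply: contraNneq vb => -[->]; exact: eqxx.
have [|rr prr] := @uniq_subset_perm _ V (right_hits D S a y0 W) uV.
  move=> v vV; apply: (right_hit (Vb vV)); apply: cov => //.
  by apply/eqP => -[E _]; move: E W0; clear; lia.
have [|rb prb] := @uniq_subset_perm _ U (bottom_hits D S a y0 W) uU.
  move=> u uin; apply: (bottom_hit (Ub uin)); apply: cov => //.
  by apply/eqP => -[_ /esym].
have [|rt prt] := @uniq_subset_perm _ U (top_hits D S a y0 W) uU.
  move=> u uin; apply: (top_hit (Ub uin)); apply: cov => //.
  by apply/eqP => -[_ /esym].
have [sl sr sb st] := size_hits D S a y0 W.
have sV' : size (rem b V) = k by rewrite size_rem // sV.
have hl := perm_size prl; have hr := perm_size prr.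
have hb := perm_size prb; have ht := perm_size prt.
rewrite sl size_cat sV' in hl; rewrite sr size_cat sV in hr.
rewrite sb size_cat sU in hb; rewrite st size_cat sU in ht.
have := count_above_below a y0 W uD; have := count_low_high a y0 W uS.
rewrite sD sS; rewrite -/above' -/below' -/low' -/high' in hl hr hb ht *.
move=> hD hS.
have [El [Er [Eb Et]]] : size rl = 0%N /\ size rr = 1%N /\
    size rb = 0%N /\ size rt = 0%N.
  by move: hl hr hb ht hD hS; clear; lia.
have [cD cS] : (count above' D = m.+1 /\ count below' D = m.+2) /\
               (count low' S = m.+1 /\ count high' S = m.+2).
  by move: hl hr hb ht hD hS; rewrite El Er Eb Et; clear; lia.
split=> //.
- by move: prl; rewrite (size0nil El) cats0.
- case: rr Er prr {hr} => [|z []] // _ prr; exists z.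
  by rewrite (permPl prr) perm_catC.
by move: prb prt; rewrite (size0nil Eb) (size0nil Et) !cats0.
Qed.

Lemma sum_offset (s : seq int) (e : int) :
  \sum_(x <- s) (x *+ 2 - e) = (\sum_(x <- s) x) *+ 2 - e *+ size s.
Proof.
elim: s => [|x s IH]; first by rewrite !big_nil mul0rn subrr.
by rewrite !big_cons IH /= mulrS; ring.
Qed.

Lemma sum_offset_sqr (s : seq int) (e : int) :
  (size s)%:Z * \sum_(x <- s) (x *+ 2 - e) ^+ 2 =
  ((size s)%:Z * \sum_(x <- s) x ^+ 2 - (\sum_(x <- s) x) ^+ 2) *+ 4 +
  ((\sum_(x <- s) x) *+ 2 - (size s)%:Z * e) ^+ 2.
Proof.
have -> : \sum_(x <- s) (x *+ 2 - e) ^+ 2 = (\sum_(x <- s) x ^+ 2) *+ 4 -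
    (\sum_(x <- s) x) * e *+ 4 + (size s)%:Z * e ^+ 2.
  elim: s => [|x s IH]; first by rewrite !big_nil /=; ring.
  rewrite !big_cons IH /= (_ : (size s).+1%:Z = (size s)%:Z + 1); last lia.
  by ring.
by ring.
Qed.

Lemma sum_filter_shift (p : pred int) (s : seq int) (f : int -> int) (c : int) :
  \sum_(x <- s | p x) (f x + c) = \sum_(x <- s | p x) f x + c *+ count p s.
Proof.
elim: s => [|x s IH]; first by rewrite !big_nil addr0.
by rewrite !big_cons /=; case: (p x); rewrite IH //= mulrS; ring.
Qed.


Lemma sum_left (g : int -> int) : \sum_(v <- left_hits D S a y0 W) g v =
  \sum_(d <- D | above' d) g (d + a) + \sum_(s <- S | low' s) g (s - a).
Proof. by rewrite big_cat !big_map !big_filter. Qed.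

Lemma sum_right (g : int -> int) : \sum_(v <- right_hits D S a y0 W) g v =
  \sum_(d <- D | below' d) g (d + (a + W)) +
  \sum_(s <- S | high' s) g (s - (a + W)).
Proof. by rewrite big_cat !big_map !big_filter. Qed.

Lemma sum_bottom (g : int -> int) : \sum_(u <- bottom_hits D S a y0 W) g u =
  \sum_(d <- D | below' d) g (y0 - d) + \sum_(s <- S | low' s) g (s - y0).
Proof. by rewrite big_cat !big_map !big_filter. Qed.

Lemma sum_top (g : int -> int) : \sum_(u <- top_hits D S a y0 W) g u =
  \sum_(d <- D | above' d) g (y0 + W - d) +
  \sum_(s <- S | high' s) g (s - (y0 + W)).
Proof. by rewrite big_cat !big_map !big_filter. Qed.

Let offU (u : int) := u *+ 2 - (a *+ 2 + W).
Let offV (v : int) := v *+ 2 - (y0 *+ 2 + W).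

(** Each line meets the two sides that it joins at the same distance from the
    middle of the side, up to the sign of the offset. *)
Lemma sqr_hits :
  \sum_(v <- left_hits D S a y0 W) offV v ^+ 2 +
  \sum_(v <- right_hits D S a y0 W) offV v ^+ 2 =
  \sum_(u <- bottom_hits D S a y0 W) offU u ^+ 2 +
  \sum_(u <- top_hits D S a y0 W) offU u ^+ 2.
Proof.
rewrite sum_left sum_right sum_bottom sum_top [RHS]addrC addrACA [RHS]addrACA.
rewrite [X in _ = _ + X]addrC.
by congr (_ + _ + (_ + _)); apply: eq_bigr => x _; rewrite /offU /offV; ring.
Qed.

(** The two main diagonals are counted on both sides, and all other lines once;
    the constants are collected by means of the known counts. *)
Lemma off_hits : count above' D = m.+1 /\ count below' D = m.+2 ->
  count low' S = m.+1 /\ count high' S = m.+2 ->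
  \sum_(v <- left_hits D S a y0 W) offV v +
  \sum_(v <- right_hits D S a y0 W) offV v =
  (\sum_(d <- D) d + \sum_(s <- S) s) *+ 2 - (y0 *+ 2 + W) *+ k *+ 2.
Proof.
move=> [cA cB] [cL cH]; have [uU uV uD uS] := nc_uniq nc.
have [sU sV sD sS] := nc_size nc.
rewrite sum_left sum_right.
have offD e (d : int) : offV (d + e) = d *+ 2 + (e *+ 2 - (y0 *+ 2 + W)).
  by rewrite /offV; ring.
have offS e (s : int) : offV (s - e) = s *+ 2 + (- e *+ 2 - (y0 *+ 2 + W)).
  by rewrite /offV; ring.
under eq_bigr do rewrite offD.
under [X in _ + X + _]eq_bigr do rewrite offS.
under [X in _ + (X + _)]eq_bigr do rewrite offD.
under [X in _ + (_ + X)]eq_bigr do rewrite offS.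
rewrite !sum_filter_shift cA cB cL cH.
have HD : \sum_(d <- D | above' d) d *+ 2 + \sum_(d <- D | below' d) d *+ 2 =
    \sum_(d <- D) d *+ 2 + (y0 - a) *+ 2.
  apply: sum_overlap => //; last by rewrite cA cB sD; clear; lia.
  by move=> d; rewrite /above' /below' /above /below; move: W0; clear; lia.
have HS : \sum_(s <- S | low' s) s *+ 2 + \sum_(s <- S | high' s) s *+ 2 =
    \sum_(s <- S) s *+ 2 + (a + y0 + W) *+ 2.
  apply: sum_overlap => //; last by rewrite cL cH sS; clear; lia.
  by move=> s; rewrite /low' /high' /low /high; move: W0; clear; lia.
rewrite addrACA [X in X + _ = _]addrACA [X in _ + X = _]addrACA HD HS !sumrMnl.
move: (\sum_(d <- D) d) (\sum_(s <- S) s) => sumD sumS.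
by rewrite (_ : k = (m.+1 + m.+1)%N); [ring | rewrite addnn].
Qed.

(** Both sums of hits are known in terms of V, b and z: the linear one gives
    that z mirrors b, and then the quadratic one that U and V have equal second
    moments about the centre of the box.  Subtracting equal variances leaves
    equal squares of the offsets of the means. *)
Lemma no_side_exception : b <> y0 -> b <> y0 + W -> False.
Proof.
move=> b0 b1; have [pl [z pr] [pb pt] cD cS] := side_hits b0 b1.
have [uU uV uD uS] := nc_uniq nc; have [sU sV sD sS] := nc_size nc.
have [aU bV] := nc_mem nc; have [Ea Eb E3] := near_cover_moments nc.
have leftE (g : int -> int) :
    \sum_(v <- left_hits D S a y0 W) g v = \sum_(v <- V) g v - g b.
  rewrite (perm_big _ pl) /= (perm_big _ (perm_to_rem bV)) big_cons /=.
  by rewrite addrAC subrr add0r.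
have rightE (g : int -> int) :
    \sum_(v <- right_hits D S a y0 W) g v = \sum_(v <- V) g v + g z.
  by rewrite (perm_big _ pr) big_cons addrC.
have := off_hits cD cS; rewrite leftE rightE sum_offset sV.
have -> : \sum_(d <- D) d + \sum_(s <- S) s = - b.
  by rewrite (nc_sumD nc) (nc_sumS nc) Eb; ring.
move=> Elin.
have Ez : offV z = - offV b.
  move: Elin; rewrite -Eb /offV -[k.+1]addn1 mulrnDr.
  move: ((y0 *+ 2 + W) *+ k) => T; clear; lia.
have := sqr_hits; rewrite leftE rightE (perm_big _ pb) (perm_big _ pt) /= Ez.
move=> Esqr.
have {Esqr} Esqr : \sum_(v <- V) offV v ^+ 2 = \sum_(u <- U) offU u ^+ 2.
  move: Esqr; rewrite sqrrN; move: (offV b ^+ 2) (\sum_(v <- V) _).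
  by move: (\sum_(u <- U) _); clear; lia.
have := sum_offset_sqr V (y0 *+ 2 + W); have := sum_offset_sqr U (a *+ 2 + W).
rewrite sU sV -/offU -/offV Esqr => ->; rewrite E3 => /addrI /eqP.
(* The offsets of the means, k + 1 times, are a - (k+1)c and b - (k+1)e, where
   (c/2, e/2) is the centre of the box, and they agree up to sign. *)
rewrite -Ea -Eb eqf_sqr => sqE.
have bb : y0 < b < y0 + W.
  by have := Vb bV; move/eqP: b0; move/eqP: b1; clear; lia.
have Wk := box_width.
have w1 : 0 < b *+ 2 - y0 *+ 2 < k%:Z *+ 4 + 2 by move: bb Wk; clear; lia.
have w2 : 0 < (y0 + W) *+ 2 - b *+ 2 < k%:Z *+ 4 + 2 by move: bb Wk; clear; lia.
have [_ N1] := small_multiple (a - y0) w1.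
have [_ N2] := small_multiple (a + y0 + W) w2.
case/orP: sqE => /eqP; rewrite -[k.+1]addn1 PoszD => E.
- apply: N1; apply/eqP; rewrite -subr_eq0; apply/eqP; move/eqP: E.
  by rewrite -subr_eq0 => /eqP E; rewrite -[RHS](mulr0 (- 2)) -E; ring.
apply: N2; apply/eqP; rewrite -subr_eq0; apply/eqP; move/eqP: E.
by rewrite -subr_eq0 => /eqP E; rewrite -[RHS](mulr0 (- 2)) -E; ring.
Qed.

End Box.
Lemma near_cover_box U V D S a b : near_cover U V D S a b ->
  exists x0 y0 W : int, [/\ 0 < W,
    [/\ x0 \in U, x0 + W \in U & forall u : int, u \in U -> x0 <= u <= x0 + W],
    [/\ y0 \in V, y0 + W \in V & forall v : int, v \in V -> y0 <= v <= y0 + W]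
    & [|| a == x0, a == x0 + W, b == y0 | b == y0 + W]].
Proof.
case=> [uq [sU sV sD sS] _ cov _ _ _].
apply: (covering_box (k := k) (D := D) (S := S)) => //.
  by rewrite /= odd_double.
by rewrite sU sV sD sS.
Qed.

Lemma no_exception_on_left U V D S a b : near_cover U V D S a b ->
  (forall u : int, u \in U -> a <= u) -> False.
Proof.
move=> nc amin.
have [x0 [y0 [W [W0 [x0U x1U Ub] [y0V y1V Vb] _]]]] := near_cover_box nc.
have [aU bV] := nc_mem nc.
have Ea : x0 = a.
  by apply/eqP; rewrite eq_le amin // andbT; case/andP: (Ub a aU).
rewrite Ea in x1U Ub.
have [Eb0|b0] := eqVneq b y0.
  exact: (no_corner_exception nc W0 x1U Ub y1V Vb Eb0).
have [Eb1|b1] := eqVneq b (y0 + W); last first.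
  exact: (no_side_exception nc W0 x1U Ub y0V y1V Vb (elimN eqP b0)
    (elimN eqP b1)).
have nc' := near_cover_swap (near_cover_reflect (near_cover_swap nc)).
apply: (no_corner_exception nc' W0 x1U Ub (y0 := - b)) => //.
  by rewrite mem_opp Eb1 (_ : - (- (y0 + W) + W) = y0) //; ring.
by move=> v; rewrite mem_opp => /Vb; rewrite Eb1; clear; lia.
Qed.

Lemma no_near_cover U V D S a b : ~ near_cover U V D S a b.
Proof.
move=> nc; have [x0 [y0 [W [_ [_ _ Ub] [_ _ Vb] bord]]]] := near_cover_box nc.
have nr := near_cover_reflect nc; have ns := near_cover_swap nc.
case/or4P: bord => /eqP E.
- by apply: (no_exception_on_left nc) => u /Ub /andP[]; rewrite E.
- apply: (no_exception_on_left nr) => u; rewrite mem_opp => /Ub; rewrite E.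
  by clear; lia.
- by apply: (no_exception_on_left ns) => v /Vb /andP[]; rewrite E.
apply: (no_exception_on_left (near_cover_reflect ns)) => v.
by rewrite mem_opp => /Vb; rewrite E; clear; lia.
Qed.

End NearCovers.

(** * From queens to covers *)

(** Meant for the list of values of a coordinate on the queens, where no value
    has multiplicity three: the doubles are then the full lines. *)
Section Doubles.
Variable s : seq int.

Definition doubles := [seq c <- undup s | (1 < count_mem c s)%N].
Definition singles := [seq c <- undup s | count_mem c s == 1%N].

Hypothesis le2 : forall c, (count_mem c s <= 2)%N.

Lemma sum_doubles_singles (R : nmodType) (g : int -> R) :
  \sum_(x <- s) g x = (\sum_(c <- doubles) g c) *+ 2 + \sum_(c <- singles) g c.
Proof.
have -> : \sum_(x <- s) g x = \sum_(c <- undup s) g c *+ count_mem c s.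
  by rewrite -big_undup_iterop_count.
rewrite -sumrMnl !big_filter [X in X + _]big_mkcond [X in _ + X]big_mkcond /=.
rewrite -big_split /= big_seq [RHS]big_seq; apply: eq_bigr => c.
rewrite mem_undup -has_pred1 has_count; move: (le2 c).
by case: (count_mem c s) => [|[|[|j]]] // _ _; rewrite ?mul0rn ?add0r ?addr0.
Qed.

Lemma size_doubles_singles : size s = ((size doubles).*2 + size singles)%N.
Proof.
have := @sum_doubles_singles nat (fun=> 1%N).
by rewrite !sum1_size => ->; rewrite -addnn.
Qed.

Lemma double_or_single c : c \in s -> (c \in doubles) || (c \in singles).
Proof.
move=> cs; rewrite !mem_filter mem_undup cs !andbT.
by move: cs; rewrite -has_pred1 has_count; case: (count_mem c s) => [|[|j]].
Qed.

End Doubles.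

Definition coord (sl : slope) (p : square) : int :=
  match sl with
  | Slope0 => p.2
  | Slope1 => p.2 - p.1
  | SlopeN1 => p.1 + p.2
  | SlopeInf => p.1
  end.

Lemma on_lineE l p : on_line l p <-> coord (line_slope l) p = line_const l.
Proof.
by case: l p => [[] c] [x y]; rewrite /on_line //= [x + y]addrC.
Qed.

Section Axis.
Variable k : nat.

Definition axis_seq : seq int := [seq i%:Z - k%:Z | i <- iota 0 k.*2.+1].

Lemma axis_uniq : uniq axis_seq.
Proof. by rewrite map_inj_uniq ?iota_uniq // => i j /addIr []. Qed.

Lemma mem_axis x : (x \in axis_seq) = (`|x| <= k%:Z).
Proof.
apply/mapP/idP => [[i]|xk]; first by rewrite mem_iota => ik ->; move: ik; lia.
by exists `|(x + k%:Z)%R|%N; rewrite ?mem_iota; move: xk; lia.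
Qed.

Lemma axis_sum : \sum_(x <- axis_seq) x = 0.
Proof.
have : \sum_(x <- [seq - x | x <- axis_seq]) x = \sum_(x <- axis_seq) x.
  apply: perm_big; apply: uniq_perm; rewrite ?uniq_opp ?axis_uniq //.
  by move=> x; rewrite mem_opp !mem_axis normrN.
by rewrite sum_opp; clear; lia.
Qed.

Lemma axis_complement (A : seq int) : uniq A -> {subset A <= axis_seq} ->
  size A = k ->
  size [seq x <- axis_seq | x \notin A] = k.+1 /\
  \sum_(x <- [seq x <- axis_seq | x \notin A]) x = - \sum_(x <- A) x.
Proof.
move=> uA sA szA.
have pA : perm_eq [seq x <- axis_seq | x \in A] A.
  apply: uniq_perm; rewrite ?filter_uniq ?axis_uniq // => x.
  by rewrite mem_filter andb_idr //; apply: sA.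
have pF : perm_eq axis_seq (A ++ [seq x <- axis_seq | x \notin A]).
  have := permEl (perm_filterC (fun x => x \in A) axis_seq).
  by rewrite perm_sym => /perm_trans; apply; rewrite perm_cat2r.
split; last first.
  have := axis_sum; rewrite (perm_big _ pF) big_cat /= addrC => /eqP.
  by rewrite addr_eq0 => /eqP.
by move: (perm_size pF); rewrite size_cat size_map size_iota szA; clear; lia.
Qed.

Lemma mem_board_axis x y :
  ((x, y) \in board k.*2.+1) = (x \in axis_seq) && (y \in axis_seq).
Proof.
rewrite mem_board /= ?odd_double // doubleK !mem_axis; lia.
Qed.

Lemma size_axis_complement (A : seq int) : (size A <= k)%N ->
  (k < size [seq x <- axis_seq | x \notin A])%N.
Proof.
move=> sA; have : (size [seq x <- axis_seq | x \in A] <= size A)%N.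
  apply: uniq_leq_size; first by rewrite filter_uniq ?axis_uniq.
  by move=> x; rewrite mem_filter => /andP[].
have : (count (fun x => x \in A) axis_seq +
        count (fun x => x \notin A) axis_seq = k.*2.+1)%N.
  rewrite -[RHS](size_iota 0) -(size_map (fun i : nat => i%:Z - k%:Z)).
  exact: (count_predC (fun x => x \in A)).
rewrite !size_filter; move: (count _ _) (count _ _) sA => c1 c2; clear; lia.
Qed.

Lemma lines_cannot_cover (A B D S : seq int) : (0 < k)%N -> ~~ odd k ->
  (size A <= k)%N -> (size B <= k)%N -> (size D <= k)%N -> (size S <= k)%N ->
  ~ (forall p, p \in board k.*2.+1 ->
     [|| p.1 \in A, p.2 \in B, p.2 - p.1 \in D | p.1 + p.2 \in S]).
Proof.
move=> k0 ek sA sB sD sS cov.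
apply: (@no_full_cover k [seq x <- axis_seq | x \notin A]
  [seq y <- axis_seq | y \notin B] (undup D) (undup S) k0 ek).
- by split; rewrite ?undup_uniq ?filter_uniq ?axis_uniq.
- split; rewrite ?size_axis_complement //.
    exact: leq_trans (size_undup _) sD.
  exact: leq_trans (size_undup _) sS.
move=> u v; rewrite !mem_filter => /andP[uA uax] /andP[vB vax].
have := cov (u, v); rewrite mem_board_axis uax vax /= (negPf uA) (negPf vB).
by rewrite /covered !mem_undup; apply.
Qed.

End Axis.

Section Queens.
Variables (m : nat) (Q : {fset square}).
Local Notation k := m.*2.+2.
Local Notation n := k.*2.+1.
Hypothesis goodQ : good n Q.
Hypothesis smallQ : (#|` Q| <= n)%N.

Local Notation lines sl := (doubles [seq coord sl p | p <- Q]).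

Lemma coord_count sl c : (count_mem c [seq coord sl p | p <- Q] <= 2)%N.
Proof.
case: goodQ => _ n3 _; rewrite leqNgt; apply/negP => c3; apply: n3.
have uF : uniq [seq p <- Q | coord sl p == c] by rewrite filter_uniq ?fset_uniq.
move: c3; rewrite count_map -size_filter.
have inF p : p \in [seq p <- Q | coord sl p == c] -> p \in Q /\ coord sl p = c.
  by rewrite mem_filter => /andP[/eqP].
rewrite (eq_filter (a2 := fun p => coord sl p == c)) //.
case: [seq p <- Q | coord sl p == c] uF inF => [|p [|q [|r F]]] //= uF inF _.
move: uF; rewrite !inE !negb_or => /andP[/and3P[pq pr _] /andP[/andP[qr _] _]].
have [|pQ cp] := inF p; first by rewrite inE eqxx.
have [|qQ cq] := inF q; first by rewrite !inE eqxx orbT.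
have [|rQ cr] := inF r; first by rewrite !inE eqxx !orbT.
exists p, q, r, (Line sl c).
by split; split=> //; first [exact/eqP | exact/on_lineE].
Qed.

(** Empty squares are allowed, so that covering the board by full lines means
    that no square outside a known set of queens is lonely. *)
Definition lonely (p : square) :=
  [&& p.1 \notin lines SlopeInf, p.2 \notin lines Slope0,
      p.2 - p.1 \notin lines Slope1 & p.1 + p.2 \notin lines SlopeN1].

Lemma mem_lines sl p q : p \in Q -> q \in Q -> p <> q ->
  coord sl p = coord sl q -> coord sl p \in lines sl.
Proof.
move=> pQ qQ pq cpq; rewrite mem_filter mem_undup map_f // andbT count_map.
rewrite -size_filter (@uniq_leq_size _ [:: p; q]) //=.
  by rewrite inE andbT; apply/eqP.
by move=> x; rewrite !inE mem_filter => /orP[] /eqP -> /=; rewrite ?cpq ?eqxx ?pQ.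
Qed.

Lemma lonelyN sl p : coord sl p \in lines sl -> ~~ lonely p.
Proof.
by case: sl => /= H; rewrite /lonely; apply/negP => /and4P[]; rewrite H.
Qed.

(** Three in a line after adding p must include p, and the two others make the
    line full. *)
Lemma empty_square_covered p : p \in board n -> p \notin Q -> ~~ lonely p.
Proof.
case: goodQ => _ n3 full pB pQ.
have [|q [r [t [l [[qQ rQ tQ] [qr qt rt] [lq lr lt]]]]]] := full p.
  by rewrite in_fsetD pQ pB.
have cover x y : x \in Q -> y \in Q -> x <> y -> on_line l p ->
    on_line l x -> on_line l y -> ~~ lonely p.
  move=> xQ yQ xy /on_lineE lp /on_lineE lx /on_lineE ly.
  apply: (@lonelyN (line_slope l)); rewrite lp -lx.
  by apply: (mem_lines xQ yQ) => //; rewrite lx ly.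
move: qQ rQ tQ; rewrite !in_fset1U.
case: (q =P p) => [qp|_] /= qQ.
  rewrite qp in qr qt lq; case: (r =P p) => [/esym//|_] /= rQ.
  by case: (t =P p) => [/esym//|_] /= tQ; apply: (cover r t).
case: (r =P p) => [rp|_] /= rQ.
  rewrite rp in qr rt lr; case: (t =P p) => [/esym//|_] /= tQ.
  by apply: (cover q t).
case: (t =P p) => [tp|_] /= tQ; first by rewrite tp in lt; apply: (cover q r).
by case: n3; exists q, r, t, l.
Qed.

Definition lonely_queens := [seq p <- Q | lonely p].

(** Lonely queens take pairwise distinct values of each coordinate, and these
    values are taken once. *)
Lemma line_bound sl :
  ((size (lines sl)).*2 + size lonely_queens <= size Q)%N.
Proof.
rewrite -(size_map (coord sl) Q) (size_doubles_singles (coord_count sl)).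
rewrite leq_add2l -(size_map (coord sl)); apply: uniq_leq_size.
  rewrite map_inj_in_uniq ?filter_uniq ?fset_uniq // => p q.
  rewrite !mem_filter => /andP[lp pQ] /andP[lq qQ] cpq.
  by apply: contrapT => pq; move: lp; apply/negP/(@lonelyN sl)/(mem_lines pQ qQ).
move=> c /mapP[p]; rewrite mem_filter => /andP[lp pQ] ->.
have /double_or_single/orP[/lonelyN|//] : coord sl p \in [seq coord sl p | p <- Q].
  by rewrite map_f.
by rewrite lp.
Qed.


Lemma lonely_covered p : p \in board n -> p \notin lonely_queens ->
  [|| p.1 \in lines SlopeInf, p.2 \in lines Slope0,
      p.2 - p.1 \in lines Slope1 | p.1 + p.2 \in lines SlopeN1].
Proof.
move=> pB; rewrite mem_filter negb_and => H.
have : ~~ lonely p.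
  by case/orP: H => // pQ; apply: empty_square_covered.
by rewrite /lonely !negb_and !negbK.
Qed.

(** With e lonely queens, each direction has room for e / 2 further lines; three
    directions absorb e / 2, e / 2 and at most one of them.  The last one fits
    unless e = 1 and all directions already have k full lines. *)
Lemma lonely_queen_unique :
  exists q0, lonely_queens = [:: q0] /\ forall sl, size (lines sl) = k.
Proof.
have ek : ~~ odd k by rewrite /= odd_double.
have cov p := @lonely_covered p.
set E := lonely_queens in cov *.
have bound sl := leq_trans (line_bound sl) smallQ; rewrite -/E in bound.
have le sl : (size (lines sl) <= k)%N.
  by move: (bound sl); move: (size (lines _)) (size E) => L e; clear; lia.
have nocov A B D S := @lines_cannot_cover k A B D S isT ek.
have [e1|e1] := eqVneq (size E) 1%N; last first.
  pose t := (size E)./2; exfalso.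
  pose E2 := drop t E.
  apply: (nocov (lines SlopeInf ++ [seq p.1 | p <- take t E])
    (lines Slope0 ++ [seq p.2 | p <- take t E2])
    (lines Slope1 ++ [seq p.2 - p.1 | p <- drop t E2]) (lines SlopeN1)).
  - rewrite size_cat size_map size_take; move: (bound SlopeInf) e1; rewrite /t.
    by clear; move: (size (doubles _)) (size E) => L e; case: ifP; lia.
  - rewrite size_cat size_map size_take size_drop; move: (bound Slope0) e1; rewrite /t.
    by clear; move: (size (doubles _)) (size E) => L e; case: ifP; lia.
  - rewrite size_cat size_map !size_drop; move: (bound Slope1) e1; rewrite /t.
    by clear; move: (size (doubles _)) (size E) => L e; lia.
  - exact: le.
  move=> p pB; rewrite !mem_cat.
  have [pE|pE] := boolP (p \in E); last first.
    by case/or4P: (cov p pB pE) => ->; rewrite ?orbT.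
  have : [|| p \in take t E, p \in take t E2 | p \in drop t E2].
    by rewrite -!mem_cat !cat_take_drop.
  case/or3P => H.
  - apply/orP; left; apply/orP; right.
    exact: (map_f (fun p : square => p.1) H).
  - apply/orP; right; apply/orP; left; apply/orP; right.
    exact: (map_f (fun p : square => p.2) H).
  apply/orP; right; apply/orP; right; apply/orP; left; apply/orP; right.
  exact: (map_f (fun p : square => p.2 - p.1) H).
case EE: E e1 => [|q0 []] // _; exists q0; split=> //.
move=> sl; apply/eqP; rewrite eqn_leq le leqNgt; apply/negP => lt.
(* Every direction with room left takes in the line through q0. *)
pose ext t := if (size (lines t) < k)%N then coord t q0 :: lines t else lines t.
have sext t : (size (ext t) <= k)%N by rewrite /ext; case: ltnP.
have lext t c : c \in lines t -> c \in ext t.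
  by rewrite /ext; case: ifP => // _; rewrite inE orbC => ->.
apply: (nocov (ext SlopeInf) (ext Slope0) (ext Slope1) (ext SlopeN1)) => // p pB.
have [pq|pq] := eqVneq p q0; last first.
  have pE : p \notin E by rewrite EE inE.
  by case/or4P: (cov p pB pE) => /lext ->; rewrite ?orbT.
have : coord sl p \in ext sl by rewrite pq /ext lt mem_head.
by case: (sl) => /= ->; rewrite ?orbT.
Qed.


(** Counting n = 2k + 1 queens along a direction with k full lines leaves one
    value taken once, that of the lonely queen.  So the sum of each coordinate
    over Q is twice the sum over full lines plus its value there, and the sums
    of y - x and x + y are the difference and the sum of those of x and y. *)
Lemma queens_near_cover :
  exists U V D S a b, near_cover m U V D S a b.
Proof.
have [q0 [Eq0 szl]] := lonely_queen_unique.
have [subQ _ _] := goodQ.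
have [/and4P[a1 b1 _ _] q0Q] : lonely q0 /\ q0 \in Q.
  by apply/andP; rewrite -mem_filter -/lonely_queens Eq0 mem_head.
have onQ p : p \in Q -> p.1 \in axis_seq k /\ p.2 \in axis_seq k.
  by move=> /(fsubsetP subQ); case: p => x y; rewrite mem_board_axis => /andP.
have sumQ sl : \sum_(p <- Q) coord sl p =
    (\sum_(c <- lines sl) c) *+ 2 + coord sl q0.
  have lonely1 : singles [seq coord sl p | p <- Q] = [:: coord sl q0].
    have := size_doubles_singles (coord_count sl); rewrite szl size_map => sz.
    have : coord sl q0 \in singles [seq coord sl p | p <- Q].
      have : coord sl q0 \in [seq coord sl p | p <- Q] by rewrite map_f.
      case/double_or_single/orP => // /lonelyN.
      have : q0 \in lonely_queens by rewrite Eq0 mem_head.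
      by rewrite mem_filter => /andP[->].
    case: (singles _) sz => [|c [|c' s]] //= sz.
      by rewrite inE => /eqP ->.
    by have := smallQ; rewrite sz; clear; lia.
  rewrite -(big_map (coord sl) predT id) /= (sum_doubles_singles (coord_count sl)).
  by rewrite lonely1 big_seq1.
have ulines sl : uniq (lines sl) by rewrite filter_uniq ?undup_uniq.
have subA : {subset lines SlopeInf <= axis_seq k}.
  by move=> c; rewrite mem_filter mem_undup => /andP[_ /mapP[p /onQ[? _] ->]].
have subB : {subset lines Slope0 <= axis_seq k}.
  by move=> c; rewrite mem_filter mem_undup => /andP[_ /mapP[p /onQ[_ ?] ->]].
have [sU sumU] := axis_complement (ulines _) subA (szl _).
have [sV sumV] := axis_complement (ulines _) subB (szl _).
have sumD : \sum_(p <- Q) coord Slope1 p =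
    \sum_(p <- Q) coord Slope0 p - \sum_(p <- Q) coord SlopeInf p.
  by rewrite -sumrB.
have sumS : \sum_(p <- Q) coord SlopeN1 p =
    \sum_(p <- Q) coord SlopeInf p + \sum_(p <- Q) coord Slope0 p.
  by rewrite -big_split.
move: sumD sumS; rewrite !sumQ /= => sumD sumS.
exists [seq x <- axis_seq k | x \notin lines SlopeInf],
  [seq y <- axis_seq k | y \notin lines Slope0], (lines Slope1), (lines SlopeN1),
  q0.1, q0.2.
have [q1ax q2ax] := onQ _ q0Q.
split.
- by rewrite !filter_uniq ?axis_uniq ?undup_uniq.
- by rewrite sU sV !szl.
- by split; rewrite mem_filter ?q1ax ?q2ax andbT.
- move=> u v; rewrite mem_filter => /andP[uA uax].
  rewrite mem_filter => /andP[vB vax] neq.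
  have := @lonely_covered (u, v); rewrite mem_board_axis uax vax /=.
  rewrite (negPf uA) (negPf vB) Eq0 inE => /(_ isT).
  by rewrite -surjective_pairing in neq; apply.
- rewrite sumU sumV; move: sumD.
  move: (\sum_(c <- lines Slope1) c) (\sum_(c <- lines SlopeInf) c)
    (\sum_(c <- lines Slope0) c) => x y z; clear; lia.
- rewrite sumU sumV; move: sumS.
  move: (\sum_(c <- lines SlopeN1) c) (\sum_(c <- lines SlopeInf) c)
    (\sum_(c <- lines Slope0) c) => x y z; clear; lia.
by split=> u; rewrite mem_filter mem_axis => /andP[].
Qed.

End Queens.


(** * The lower bound *)

Local Close Scope ring_scope.

Theorem theorem2 (n : nat) (hn5 : 5 <= n) (hn1 : n = 1 %[mod 4]) :
  n + 1 <= m3 n /\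
  (forall Q : {fset square}, good n Q -> n + 1 <= #|` Q|%fset).
Proof.
have main (Q : {fset square}) : good n Q -> (n + 1 <= #|` Q|%fset)%N.
  move=> gQ; rewrite leqNgt addn1 ltnS; apply/negP => sQ.
  have [m En] : exists m, n = m.*2.+2.*2.+1.
    by exists (n %/ 4 - 1)%N; move: hn5 hn1; clear; lia.
  move: gQ sQ; rewrite En => gQ sQ.
  have [U [V [D [S [a [b nc]]]]]] := queens_near_cover gQ sQ.
  exact: no_near_cover nc.
split=> //; rewrite /m3; case: ex_minnP => k /asboolP[Q gQ <-] _; exact: main.
Qed.
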